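(* Let $F$ be a formal group over $\mathbb{C}$ with $\log F=f$. The map $\mathcal{F}$, defined by $\mathcal{F}(V)=V_{F}$ for every vertex algebra (resp. nonlocal vertex algebra) $V$ and $\mathcal{F}(\theta)=\theta$ for every homomorphism $\theta$ of vertex algebras (resp. nonlocal vertex algebras), is an isomorphism from the category of vertex algebras (resp. nonlocal vertex algebras) to the category of vertex $F$-algebras (resp. nonlocal vertex $F$-algebras). Here, for $V=(V,Y,\mathbf{1})$, $V_F=(V,Y_F,\mathbf{1})$ with $Y_F(v,x)=Y(v,f(x))$ for $v\in V$.
   Context: All vector spaces are over $\mathbb{C}$. A (one-dimensional) formal group over $\mathbb{C}$ is $F(x,y)\in\mathbb{C}[[x,y]]$ with $F(x,0)=x$, $F(0,y)=y$, $F(x,F(y,z))=F(F(x,y),z)$; it is automatically commutative. Its logarithm $\log F$ is the unique $f(x)\in\mathbb{C}[[x]]$ with $f(0)=0$, $f'(0)=1$, $f(F(x,y))=f(x)+f(y)$. A nonlocal vertex $F$-algebra is a vector space $V$ with a linear map $Y(\cdot,x):V\to \mathrm{Hom}(V,V((x)))$, $v\mapsto Y(v,x)=\sum_{n\in\mathbb{Z}}v_nx^{-n-1}$, and a vector $\mathbf{1}\in V$ such that (vacuum and creation) $Y(\mathbf{1},x)v=v$, $Y(v,x)\mathbf{1}\in V[[x]]$ and $\lim_{x\to0}Y(v,x)\mathbf{1}=v$ for $v\in V$; (weak $F$-associativity) for $u,v,w\in V$ there exists a nonnegative integer $l$ such that $$F(x_0,x_2)^lY(u,F(x_0,x_2))Y(v,x_2)w=F(x_0,x_2)^lY(Y(u,x_0)v,x_2)w,$$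 where in $Y(u,F(x_0,x_2))$ the powers $F(x_0,x_2)^m$, $m\in\mathbb{Z}$, are expanded in $\mathbb{C}((x_0))[[x_2]]$. A vertex $F$-algebra is a nonlocal vertex $F$-algebra satisfying weak commutativity: for $u,v\in V$ there exists a nonnegative integer $k$ with $(x_1-x_2)^kY(u,x_1)Y(v,x_2)=(x_1-x_2)^kY(v,x_2)Y(u,x_1)$. A (nonlocal) vertex algebra is a (nonlocal) vertex $F_{\rm a}$-algebra for the additive formal group $F_{\rm a}(x,y)=x+y$. $Y(v,f(x))=\sum_n v_n\,f(x)^{-n-1}$, where $f(x)^m\in x^m\mathbb{C}[[x]]$ for $m\in\mathbb{Z}$. In each category, a homomorphism $\theta$ is a linear map with $\theta(\mathbf{1})=\mathbf{1}$ and $\theta(Y(u,x)v)=Y(\theta(u),x)\theta(v)$ for all $u,v$ (with the respective vertex operator maps). *)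

(* Defs.v *)
From HB Require Import structures.
From mathcomp Require Import all_boot all_order all_algebra.
From mathcomp Require Import boolp classical_sets fsbigop reals.
From mathcomp Require Export complex.

Set Implicit Arguments.
Unset Strict Implicit.
Unset Printing Implicit Defensive.

Import GRing.Theory.
Local Open Scope classical_set_scope.
Local Open Scope ring_scope.

(* Convention: a power series in K[[x]] (resp. K[[x,y]]) is its coefficient
   function nat -> K (resp. nat -> nat -> K); a doubly infinite series in two
   variables with coefficients in W is a function int -> int -> W.  The sums
   \sum_(i \in A) are finitely supported sums; each one below has finite
   support whenever it is applied to series for which the corresponding formal
   expression is defined. *)

Section FormalSeries.
Variable K : fieldType.

Definition fps1 := nat -> K.
Definition fps2 := nat -> nat -> K.

Definition fps2_one : fps2 := fun i j => ((i == 0%N) && (j == 0%N))%:R.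
Definition fps2_x : fps2 := fun i j => ((i == 1%N) && (j == 0%N))%:R.
Definition fps2_y : fps2 := fun i j => ((i == 0%N) && (j == 1%N))%:R.

Definition fps2_add (A B : fps2) : fps2 := fun i j => A i j + B i j.
Definition fps2_sub (A B : fps2) : fps2 := fun i j => A i j - B i j.
Definition fps2_mul (A B : fps2) : fps2 := fun i j =>
  \sum_(a < i.+1) \sum_(b < j.+1) A a b * B (i - a)%N (j - b)%N.
Definition fps2_exp (A : fps2) (n : nat) : fps2 :=
  iter n (fps2_mul A) fps2_one.

(* f(x), f(y) and f(A(x,y)), where A(0,0) = 0 *)
Definition fps_in_x (f : fps1) : fps2 := fun i j => if j == 0%N then f i else 0.
Definition fps_in_y (f : fps1) : fps2 := fun i j => if i == 0%N then f j else 0.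
Definition fps_comp (f : fps1) (A : fps2) : fps2 := fun i j =>
  \sum_(n \in [set: nat]) f n * fps2_exp A n i j.

(* For F = \sum F_(m,n) x^m y^n the third axiom compares the coefficients of
   x^i y^j z^k in F(x,F(y,z)) and F(F(x,y),z). *)
Record formal_group (F : fps2) : Prop := FormalGroup {
  formal_group_x0 : forall i, F i 0%N = (i == 1%N)%:R ;
  formal_group_0y : forall j, F 0%N j = (j == 1%N)%:R ;
  formal_group_assoc : forall i j k,
    \sum_(n \in [set: nat]) F i n * fps2_exp F n j k =
    \sum_(m \in [set: nat]) F m k * fps2_exp F m i j }.

Definition additive_fg : fps2 := fps2_add fps2_x fps2_y.

Record is_log (F : fps2) (f : fps1) : Prop := IsLog {
  log_0 : f 0%N = 0 ;
  log_deriv0 : f 1%N = 1 ;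
  log_morph : fps_comp f F = fps2_add (fps_in_x f) (fps_in_y f) }.

(* The binomial coefficient m(m-1)...(m-k+1)/k!; for m = -(n+1) it equals
   (-1)^k binom(n+k, k). *)
Definition binz (m : int) (k : nat) : K :=
  match m with
  | Posz n => 'C(n, k)%:R
  | Negz n => (-1) ^+ k * 'C(n + k, k)%:R
  end.

Definition fps2_coefz (A : fps2) (i j : int) : K :=
  match i, j with Posz a, Posz b => A a b | _, _ => 0 end.

(* The coefficient of x^i y^j in A(x,y)^m, m an integer, expanded as
     A^m = (x + (A - x))^m = \sum_(k >= 0) binom(m,k) x^(m-k) (A - x)^k.
   It is used for two kinds of A:
   - A = F a formal group: y divides F - x because F(x,0) = x, so this is the
     m-th power of F in the ring K((x))[[y]], where F is invertible;
   - A = f(x) with f(0) = 0, f'(0) = 1: x^2 divides f(x) - x, so this is the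
     m-th power of f(x) in K((x)). *)
Definition fps2_expz (A : fps2) (m i j : int) : K :=
  \sum_(k \in [set: nat])
     binz m k * fps2_coefz (fps2_exp (fps2_sub A fps2_x) k) (i - m + k%:Z) j.

Definition fps1_expz (f : fps1) (m i : int) : K :=
  fps2_expz (fps_in_x f) m i 0.

Definition fps2_act (W : lmodType K) (A : fps2) (S : int -> int -> W) :
    int -> int -> W := fun i j =>
  \sum_(p \in [set: nat * nat]) A p.1 p.2 *: S (i - p.1%:Z) (j - p.2%:Z).

End FormalSeries.

Arguments fps2_x {K}.
Arguments fps2_y {K}.
Arguments additive_fg {K}.

Section VertexFAlgebras.
Variable K : fieldType.

(* mode u n v is u_n v, i.e. Y(u,x)v = \sum_n (mode u n v) x^(-n-1) *)
Record vertex_data := VertexData {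
  carrier :> lmodType K ;
  mode : carrier -> int -> carrier -> carrier ;
  vacuum : carrier }.

(* Y is a linear map V -> Hom(V, V((x))) *)
Record is_vertex_operator (V : vertex_data) : Prop := IsVertexOperator {
  mode_linear_l : forall (n : int) (v : V), linear (fun u : V => mode u n v) ;
  mode_linear_r : forall (u : V) (n : int), linear (mode u n) ;
  mode_truncation : forall u v : V,
    exists N : int, forall n : int, N <= n -> mode u n v = 0 }.

Record vacuum_creation (V : vertex_data) : Prop := VacuumCreation {
  vacuum_mode : forall (n : int) (v : V),
    mode (vacuum V) n v = if n == -1 then v else 0 ;
  creation_regular : forall (v : V) (n : int), 0 <= n -> mode v n (vacuum V) = 0 ;
  creation_limit : forall v : V, mode v (-1) (vacuum V) = v }.

(* Coefficients of x^i y^j in Y(u,x) Y(v,y) w, in Y(u,F(x,y)) Y(v,y) w and in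
   Y(Y(u,x)v, y) w. *)
Definition YY (V : vertex_data) (u v w : V) : int -> int -> V := fun i j =>
  mode u (- i - 1) (mode v (- j - 1) w).
Definition YF_Y (F : fps2 K) (V : vertex_data) (u v w : V) : int -> int -> V :=
  fun i j => \sum_(p \in [set: int * int])
    fps2_expz F (- p.1 - 1) i (j + p.2 + 1) *: mode u p.1 (mode v p.2 w).
Definition Y_Y (V : vertex_data) (u v w : V) : int -> int -> V := fun i j =>
  mode (mode u (- i - 1) v) (- j - 1) w.

Definition weak_F_associativity (F : fps2 K) (V : vertex_data) : Prop :=
  forall u v w : V, exists l : nat,
    fps2_act (fps2_exp F l) (YF_Y F u v w) = fps2_act (fps2_exp F l) (Y_Y u v w).

Record nonlocal_vertex_F_algebra (F : fps2 K) (V : vertex_data) : Prop :=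
  NonlocalVertexFAlgebra {
    nlv_operator : is_vertex_operator V ;
    nlv_vacuum : vacuum_creation V ;
    nlv_assoc : weak_F_associativity F V }.

Definition weak_commutativity (V : vertex_data) : Prop :=
  forall u v : V, exists k : nat, forall w : V,
    fps2_act (fps2_exp (fps2_sub fps2_x fps2_y) k) (YY u v w) =
    fps2_act (fps2_exp (fps2_sub fps2_x fps2_y) k) (fun i j => YY v u w j i).

Record vertex_F_algebra (F : fps2 K) (V : vertex_data) : Prop := VertexFAlgebra {
  vfa_nonlocal : nonlocal_vertex_F_algebra F V ;
  vfa_commutativity : weak_commutativity V }.

Definition nonlocal_vertex_algebra : vertex_data -> Prop :=
  nonlocal_vertex_F_algebra additive_fg.
Definition vertex_algebra : vertex_data -> Prop := vertex_F_algebra additive_fg.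

Record is_vertex_hom (V W : vertex_data) (theta : V -> W) : Prop := IsVertexHom {
  vhom_linear : linear theta ;
  vhom_vacuum : theta (vacuum V) = vacuum W ;
  vhom_mode : forall (u v : V) (n : int),
    theta (mode u n v) = mode (theta u) n (theta v) }.

(* V_F = (V, Y_F, 1) with Y_F(v,x) = Y(v,f(x)) = \sum_n v_n f(x)^(-n-1): the
   m-th mode is the coefficient of x^(-m-1). *)
Definition twist (f : fps1 K) (V : vertex_data) : vertex_data :=
  {| carrier := carrier V ;
     mode := fun u m v => \sum_(n \in [set: int])
               fps1_expz f (- n - 1) (- m - 1) *: mode u n v ;
     vacuum := vacuum V |}.

End VertexFAlgebras.

Record category := Category {
  ob :> Type ;
  hom : ob -> ob -> Type ;
  idm : forall a, hom a a ;
  comp : forall a b c, hom b c -> hom a b -> hom a c ;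
  comp_idl : forall a b (h : hom a b), comp (idm b) h = h ;
  comp_idr : forall a b (h : hom a b), comp h (idm a) = h ;
  compA : forall a b c d (h : hom c d) (g : hom b c) (e : hom a b),
    comp h (comp g e) = comp (comp h g) e }.

Record functor (C D : category) := Functor {
  fob :> C -> D ;
  fmap : forall a b, hom a b -> hom (fob a) (fob b) ;
  fmap_id : forall a, fmap (idm a) = idm (fob a) ;
  fmap_comp : forall a b c (h : hom b c) (g : hom a b),
    fmap (comp h g) = comp (fmap h) (fmap g) }.

Definition functor_id (C : category) : functor C C :=
  @Functor C C (fun a => a) (fun a b h => h)
    (fun a => erefl) (fun a b c h g => erefl).

Section FunctorComp.
Variables (C D E : category) (G : functor D E) (F : functor C D).

Let Gob (a : C) : E := G (F a).
Let Gmap (a b : C) (h : hom a b) : hom (Gob a) (Gob b) := fmap G (fmap F h).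

Fact functor_comp_id a : Gmap (idm a) = idm (Gob a).
Proof. by rewrite /Gmap !fmap_id. Qed.

Fact functor_comp_comp a b c (h : hom b c) (g : hom a b) :
  Gmap (comp h g) = comp (Gmap h) (Gmap g).
Proof. by rewrite /Gmap !fmap_comp. Qed.

Definition functor_comp : functor C E :=
  Functor functor_comp_id functor_comp_comp.

End FunctorComp.

Definition is_isomorphism (C D : category) (F : functor C D) : Prop :=
  exists G : functor D C,
    functor_comp G F = functor_id C /\ functor_comp F G = functor_id D.

Section VertexCategories.
Variable K : fieldType.
Implicit Type P : vertex_data K -> Prop.

Definition vertex_ob P := {V : vertex_data K | P V}.
Definition vertex_hom P (V W : vertex_ob P) :=
  {theta : sval V -> sval W | is_vertex_hom theta}.

Fact vertex_idm_subproof (V : vertex_data K) : is_vertex_hom (fun v : V => v).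
Proof. by split. Qed.

Fact vertex_comp_subproof (U V W : vertex_data K) (h : V -> W) (g : U -> V) :
  is_vertex_hom h -> is_vertex_hom g -> is_vertex_hom (fun u => h (g u)).
Proof.
move=> [hl h1 hm] [gl g1 gm]; split.
- by move=> a u v; rewrite gl hl.
- by rewrite g1 h1.
- by move=> u v n; rewrite gm hm.
Qed.

Definition vertex_idm P (V : vertex_ob P) : vertex_hom V V :=
  exist _ (fun v => v) (vertex_idm_subproof (sval V)).
Definition vertex_comp P (U V W : vertex_ob P)
    (h : vertex_hom V W) (g : vertex_hom U V) : vertex_hom U W :=
  exist _ (fun u => sval h (sval g u))
    (vertex_comp_subproof (svalP h) (svalP g)).

Fact vertex_comp_idl P (V W : vertex_ob P) (h : vertex_hom V W) :
  vertex_comp (vertex_idm W) h = h.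
Proof. by case: h => h hP; apply: eq_exist. Qed.

Fact vertex_comp_idr P (V W : vertex_ob P) (h : vertex_hom V W) :
  vertex_comp h (vertex_idm V) = h.
Proof. by case: h => h hP; apply: eq_exist. Qed.

Fact vertex_compA P (T U V W : vertex_ob P) (h : vertex_hom V W)
    (g : vertex_hom U V) (e : vertex_hom T U) :
  vertex_comp h (vertex_comp g e) = vertex_comp (vertex_comp h g) e.
Proof. exact: eq_exist. Qed.

Definition vertex_category P : category :=
  Category (@vertex_comp_idl P) (@vertex_comp_idr P) (@vertex_compA P).

Section TwistFunctor.
Variables (f : fps1 K) (P Q : vertex_data K -> Prop).
Hypothesis twist_ob : forall V, P V -> Q (twist f V).
Hypothesis twist_hom : forall (V W : vertex_data K) (theta : V -> W),
  P V -> P W -> is_vertex_hom theta ->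
  @is_vertex_hom K (twist f V) (twist f W) theta.

Let tob (V : vertex_category P) : vertex_category Q :=
  exist _ (twist f (sval V)) (twist_ob (svalP V)).
Let tmap (V W : vertex_category P) (theta : hom V W) : hom (tob V) (tob W) :=
  exist _ (sval theta) (twist_hom (svalP V) (svalP W) (svalP theta)).

Fact twist_functor_id V : tmap (idm V) = idm (tob V).
Proof. exact: eq_exist. Qed.

Fact twist_functor_comp U V W (h : hom V W) (g : hom U V) :
  tmap (comp h g) = comp (tmap h) (tmap g).
Proof. exact: eq_exist. Qed.

(* V |-> V_F on objects and theta |-> theta on morphisms, given that V_F and
   theta belong to the target category. *)
Definition twist_functor : functor (vertex_category P) (vertex_category Q) :=
  Functor twist_functor_id twist_functor_comp.

End TwistFunctor.

(* The map V |-> V_F, theta |-> theta is a well-defined functor from the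
   category of structures satisfying P to that of structures satisfying Q, and
   it is an isomorphism of categories. *)
Definition twist_is_isomorphism (f : fps1 K)
    (P Q : vertex_data K -> Prop) : Prop :=
  exists (Hob : forall V, P V -> Q (twist f V))
         (Hhom : forall (V W : vertex_data K) (theta : V -> W),
            P V -> P W -> is_vertex_hom theta ->
            @is_vertex_hom K (twist f V) (twist f W) theta),
    is_isomorphism (twist_functor Hob Hhom).

End VertexCategories.

(* Main.v *)
Require Import Defs.
From mathcomp Require Import all_boot all_order all_algebra reals.
From mathcomp Require Import boolp classical_sets functions cardinality fsbigop.
From mathcomp Require Import zify.

(* Let g be the compositional inverse of f, so that F(x,y) = g(f(x) + f(y)).
   Twisting by f and by g are mutually inverse, and both transport the axioms by
   one argument.  If h(G(x,y)) = H(h(x),h(y)), the substitution x -> h(x),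
   y -> h(y) turns weak H-associativity of Y into weak G-associativity of
   Y(v,h(x)): it maps H(x,y)^l to h(G(x,y))^l, which divides G(x,y)^l, since x is
   a multiple of h(x).  Weak commutativity is transported because
   h(x) - h(y) divides x - y.

   Substitutions act on series indexed by Z^2 through matrices which are lower
   triangular for a locally finite order.  The matrix of x -> X, y -> Y is
   determined by its column of index (0,0) and by the property that
   multiplication by X and by Y shifts the columns, because these
   multiplications are injective on series whose support is bounded below.
   Hence negative powers never have to be manipulated, and two composites of
   substitutions agree as soon as they send x and y to the same series. *)

Set Implicit Arguments.
Unset Strict Implicit.
Unset Printing Implicit Defensive.

Import Order.TTheory GRing.Theory Num.Theory.
Local Open Scope classical_set_scope.
Local Open Scope ring_scope.

(** * Finitely supported sums *)

Section FiniteSums.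

Lemma fsum_seq (T : choiceType) (W : nmodType) (r : seq T) (F : T -> W) :
  uniq r -> (forall i, F i != 0 -> i \in r) ->
  \sum_(i \in [set: T]) F i = \sum_(i <- r) F i.
Proof.
move=> ur Fr; rewrite (fsbigE r) //.
  by apply: eq_bigl => i; rewrite in_setT.
by move=> i _ ir; apply/eqP; apply: contraNT ir; apply: Fr.
Qed.

Lemma fsum_undup (T : choiceType) (W : nmodType) (r : seq T) (F : T -> W) :
  (forall i, F i != 0 -> i \in r) ->
  \sum_(i \in [set: T]) F i = \sum_(i <- undup r) F i.
Proof.
by move=> Fr; apply: fsum_seq (undup_uniq _) _ => i /Fr; rewrite mem_undup.
Qed.

Lemma eq_fsum (T : choiceType) (W : nmodType) (F G : T -> W) :
  F =1 G -> \sum_(i \in [set: T]) F i = \sum_(i \in [set: T]) G i.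
Proof. by move=> FG; apply: eq_fsbigr => i _. Qed.

Lemma fsum0 (T : choiceType) (W : nmodType) (F : T -> W) :
  (forall i, F i = 0) -> \sum_(i \in [set: T]) F i = 0.
Proof. by move=> F0; apply: fsbig1 => i _. Qed.

Lemma fsum1 (T : choiceType) (W : nmodType) (j : T) (F : T -> W) :
  (forall i, i != j -> F i = 0) -> \sum_(i \in [set: T]) F i = F j.
Proof.
move=> F0; rewrite (@fsum_seq _ _ [:: j]) ?big_seq1 // => i.
by apply: contraR; rewrite inE => /F0 ->.
Qed.

Lemma fsum_neq0 (T : choiceType) (W : nmodType) (F : T -> W) :
  \sum_(i \in [set: T]) F i != 0 -> exists i, F i != 0.
Proof.
move=> F0; apply: contrapT => nF; move/eqP: F0; apply.
by apply: fsum0 => i; apply/eqP; apply: contra_notT nF => Fi; exists i.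
Qed.

(** A finitely supported sum takes the value 0 when its support is infinite, so Fubini is applied
    only to a joint support inside a finite rectangle. *)
Lemma fsum_exchange (A B : choiceType) (W : nmodType) (g : A -> B -> W)
    (s : seq A) (t : seq B) :
  (forall a b, g a b != 0 -> (a \in s) && (b \in t)) ->
  \sum_(a \in [set: A]) \sum_(b \in [set: B]) g a b =
  \sum_(b \in [set: B]) \sum_(a \in [set: A]) g a b.
Proof.
move=> st.
have sa a : \sum_(b \in [set: B]) g a b = \sum_(b <- undup t) g a b.
  by apply: fsum_undup => b /st/andP[].
have sb b : \sum_(a \in [set: A]) g a b = \sum_(a <- undup s) g a b.
  by apply: fsum_undup => a /st/andP[].
rewrite (@fsum_undup _ _ s); last by move=> a /fsum_neq0[b /st/andP[]].
rewrite [RHS](@fsum_undup _ _ t); last by move=> b /fsum_neq0[a /st/andP[]].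
under eq_bigr do rewrite sa; under [RHS]eq_bigr do rewrite sb.
exact: exchange_big.
Qed.

Lemma fsum_pair (A B : choiceType) (W : nmodType) (g : A * B -> W)
    (s : seq A) (t : seq B) :
  (forall a b, g (a, b) != 0 -> (a \in s) && (b \in t)) ->
  \sum_(p \in [set: A * B]) g p =
  \sum_(a \in [set: A]) \sum_(b \in [set: B]) g (a, b).
Proof.
move=> st.
have sa a : \sum_(b \in [set: B]) g (a, b) = \sum_(b <- undup t) g (a, b).
  by apply: fsum_undup => b /st/andP[].
rewrite [RHS](@fsum_undup _ _ s); last by move=> a /fsum_neq0[b /st/andP[]].
under [RHS]eq_bigr do rewrite sa.
transitivity (\sum_(p <- [seq (a, b) | a <- undup s, b <- undup t]) g p).
  2: by rewrite big_allpairs_dep.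
apply: fsum_seq => [|[a b] /st/andP[ias ibt]].
  by apply: allpairs_uniq; rewrite ?undup_uniq // => -[a b] [c d].
by apply/allpairsP; exists (a, b); rewrite !mem_undup ias ibt.
Qed.

Lemma fsum_reindex (A B : choiceType) (W : nmodType) (h : A -> B)
    (F : B -> W) :
  injective h -> (forall b, F b != 0 -> exists a, b = h a) ->
  \sum_(b \in [set: B]) F b = \sum_(a \in [set: A]) F (h a).
Proof.
move=> inj_h Fh; rewrite -(fsbig_image setT h F);
  last by move=> ? ? _ _; apply: inj_h.
apply/esym/fsbig_widen => // b [_ /=] nb; apply/eqP; apply: contra_notT nb.
by move=> /Fh[a ->]; exists a.
Qed.

Lemma fsum_add (T : choiceType) (W : nmodType) (r : seq T) (F G : T -> W) :
  (forall i, F i != 0 -> i \in r) -> (forall i, G i != 0 -> i \in r) ->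
  \sum_(i \in [set: T]) (F i + G i) =
  \sum_(i \in [set: T]) F i + \sum_(i \in [set: T]) G i.
Proof.
move=> Fr Gr; rewrite (fsum_undup Fr) (fsum_undup Gr) -big_split /=.
apply: fsum_undup => i; apply: contraR => ir.
rewrite (contraNeq (Fr i) ir) (contraNeq (Gr i) ir) ?addr0 //.
Qed.

Lemma linear_scale (K : fieldType) (U W : lmodType K) (theta : U -> W) c u :
  linear theta -> theta (c *: u) = c *: theta u.
Proof.
move=> lin; have t0 : theta 0 = 0.
  by have := lin (-1) 0 0; rewrite !scaleN1r !addNr.
by have := lin c u 0; rewrite t0 !addr0.
Qed.

Lemma linear_zero (K : fieldType) (U W : lmodType K) (theta : U -> W) :
  linear theta -> theta 0 = 0.
Proof. by move=> /(linear_scale 0 0); rewrite !scale0r. Qed.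

Lemma fsum_linear (K : fieldType) (T : choiceType) (V W : lmodType K)
    (theta : V -> W) (r : seq T) (F : T -> V) :
  linear theta -> (forall i, F i != 0 -> i \in r) ->
  theta (\sum_(i \in [set: T]) F i) = \sum_(i \in [set: T]) theta (F i).
Proof.
move=> lin Fr; have t0 := linear_zero lin.
have tD u v : theta (u + v) = theta u + theta v.
  by have := lin 1 u v; rewrite !scale1r.
rewrite (fsum_undup Fr) (big_morph theta tD t0).
apply/esym/fsum_undup => i; apply: contraR => /(contraNeq (Fr i)) ->.
by rewrite t0.
Qed.

(** No finiteness is assumed: over a field, scaling by a nonzero constant preserves the support, and
    on an infinite support both sides take the default value 0. *)
Lemma scale_fsumr (K : fieldType) (T : choiceType) (W : lmodType K) (c : K)
    (F : T -> W) :
  c *: (\sum_(i \in [set: T]) F i) = \sum_(i \in [set: T]) c *: F i.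
Proof.
have [->|c0] := eqVneq c 0;
  first by rewrite scale0r fsum0 // => i; rewrite scale0r.
have supp : (fun i => c *: F i) @^-1` [set~ 0] = F @^-1` [set~ 0].
  apply/seteqP; split=> i /=; apply: contra_not; first by move->; rewrite scaler0.
  by move/eqP; rewrite scaler_eq0 (negPf c0) => /eqP.
case: (pselect (finite_set (F @^-1` [set~ 0]))) => [|inf]; last first.
  by rewrite !fsbig_dflt ?scaler0 // setTI ?supp.
case/finite_seqP => r Fr.
have inr i : F i != 0 -> i \in r.
  by move=> /eqP Fi; have : [set` r] i by rewrite -Fr.
rewrite (fsum_undup inr) scaler_sumr; apply/esym/fsum_undup => i.
by rewrite scaler_eq0 negb_or => /andP[_ /inr].
Qed.

Lemma scale_fsuml (K : fieldType) (T : choiceType) (W : lmodType K)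
    (F : T -> K) (v : W) :
  (\sum_(i \in [set: T]) F i) *: v = \sum_(i \in [set: T]) F i *: v.
Proof.
have [->|v0] := eqVneq v 0;
  first by rewrite scaler0 fsum0 // => i; rewrite scaler0.
have supp : (fun i => F i *: v) @^-1` [set~ 0] = F @^-1` [set~ 0].
  apply/seteqP; split=> i /=; apply: contra_not; first by move->; rewrite scale0r.
  by move/eqP; rewrite scaler_eq0 (negPf v0) orbF => /eqP.
case: (pselect (finite_set (F @^-1` [set~ 0]))) => [|inf]; last first.
  by rewrite !fsbig_dflt ?scale0r // setTI ?supp.
case/finite_seqP => r Fr.
have inr i : F i != 0 -> i \in r.
  by move=> /eqP Fi; have : [set` r] i by rewrite -Fr.
rewrite (fsum_undup inr) scaler_suml; apply/esym/fsum_undup => i.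
by rewrite scaler_eq0 negb_or => /andP[/inr].
Qed.

End FiniteSums.

(** * Kernels on doubly infinite series *)

Section Kernels.
Variable K : fieldType.

(** Matrices indexed by the monomials of x and y: the first argument is the row, the second the
    column. *)
Definition kernel := int * int -> int * int -> K.

Definition act (W : lmodType K) (N : kernel) (S : int * int -> W) :
    int * int -> W := fun i => \sum_(p \in [set: int * int]) N i p *: S p.

Definition kmul (N M : kernel) : kernel := fun i p =>
  \sum_(a \in [set: int * int]) N i a * M a p.

Definition quad (p i : int * int) := (p.1 <= i.1) && (p.2 <= i.2).
(* The monomials of A(x,y)^m have y-degree at least 0 and, for y of weight 2,
   weight at least m: [shear] makes x -> A(x,y) lower triangular. *)
Definition shear (p i : int * int) :=
  (p.2 <= i.2) && (p.1 + 2 * p.2 <= i.1 + 2 * i.2).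

Definition zrange (m n : int) : seq int :=
  [seq m + k%:Z | k <- iota 0 `|n - m|%N.+1].

(** A finite set containing the [shear] interval from p to i: there b lies between p.2 and i.2, and
    the bounds on the weight a + 2b then bound a. *)
Definition box (p i : int * int) : seq (int * int) :=
  [seq (a, b) | a <- zrange (p.1 + 2 * p.2 - 2 * i.2) (i.1 + 2 * i.2 - 2 * p.2),
                b <- zrange p.2 i.2].

Lemma mem_zrange m n a : m <= a -> a <= n -> a \in zrange m n.
Proof.
move=> ma an; apply/mapP; exists `|a - m|%N; first by rewrite mem_iota; lia.
by lia.
Qed.

Lemma mem_box p i a : shear p a -> shear a i -> a \in box p i.
Proof.
case: p i a => [p q] [i j] [a b]; rewrite /shear /= => /andP[? ?] /andP[? ?].
by apply/allpairsP; exists (a, b); rewrite /= !mem_zrange //; lia.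
Qed.

(** Two orders are needed: [shear] for x -> F(x,y), and the smaller [quad] for Y(Y(u,x)v,y)w, where
    the least exponent of y depends on the exponent of x, so that local finiteness for [shear] can
    fail. *)
Definition finer (r : rel (int * int)) := transitive r /\ subrel r shear.

Lemma finer_shear : finer shear.
Proof.
split=> // -[p q] [i j] [a b]; rewrite /shear /= => /andP[? ?] /andP[? ?].
by apply/andP; split; lia.
Qed.

Lemma finer_quad : finer quad.
Proof.
split=> [[p q] [i j] [a b]|[p q] [i j]]; rewrite /shear /quad /= => /andP[? ?].
  by move=> /andP[? ?]; apply/andP; split; lia.
by apply/andP; split; lia.
Qed.

Definition lower (r : rel (int * int)) (N : kernel) :=
  forall i p, N i p != 0 -> r p i.

(** This makes every entry of a lower triangular matrix applied to S a finite sum. *)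
Definition locfin (r : rel (int * int)) (W : lmodType K) (S : int * int -> W) :=
  forall i, exists s : seq (int * int),
    forall p, r p i -> S p != 0 -> p \in s.

Lemma lower_quad N : lower quad N -> lower shear N.
Proof. by move=> lN i p /lN/(proj2 finer_quad). Qed.

Lemma locfin_quad (W : lmodType K) (S : int * int -> W) :
  locfin shear S -> locfin quad S.
Proof.
by move=> lS i; have [s sP] := lS i; exists s => p /(proj2 finer_quad)/sP.
Qed.

Section Associativity.
Variables (r : rel (int * int)) (r_fin : finer r).
Variable W : lmodType K.
Implicit Types (N M : kernel) (S : int * int -> W).

Lemma lower_kmul N M : lower r N -> lower r M -> lower r (kmul N M).
Proof.
move=> lN lM i p /fsum_neq0[a]; rewrite mulf_eq0 negb_or => /andP[/lN ai /lM pa].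
exact: (proj1 r_fin) pa ai.
Qed.

Lemma act_neq0 N S i : lower r N -> act N S i != 0 ->
  exists a, [&& r a i, N i a != 0 & S a != 0].
Proof.
move=> lN /fsum_neq0[a]; rewrite scaler_eq0 negb_or => /andP[Na Sa].
by exists a; rewrite lN ?Na.
Qed.

Lemma locfin_act N S : lower r N -> locfin r S -> locfin r (act N S).
Proof.
move=> lN lS i; have [s sP] := lS i.
exists (flatten [seq box a i | a <- s]) => p pri /(act_neq0 lN)[a /and3P[ap _ Sa]].
have ari := proj1 r_fin _ _ _ ap pri.
apply/flatten_mapP; exists a; first exact: sP.
by apply: mem_box; apply: (proj2 r_fin).
Qed.

(** For a fixed row i, only the finitely many p below i in the support of S matter, and for each of
    them the intermediate indices lie in a box. Hence the two sums can be exchanged. *)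
Lemma act_kmul N M S : lower r N -> lower r M -> locfin r S ->
  act N (act M S) = act (kmul N M) S.
Proof.
move=> lN lM lS; apply/funext => i; have [s sP] := lS i.
rewrite /act /kmul; under eq_fsum do rewrite scale_fsumr.
under [RHS]eq_fsum do rewrite scale_fsuml.
rewrite (@fsum_exchange _ _ _ _ (flatten [seq box a i | a <- s]) s) => [|a p].
  by apply: eq_fsum => p; apply: eq_fsum => a; rewrite scalerA.
rewrite !scaler_eq0 !negb_or => /and3P[/lN ai /lM pa Sp].
have pi := proj1 r_fin _ _ _ pa ai; rewrite (sP p) // andbT.
apply/flatten_mapP; exists p; first exact: sP.
by apply: mem_box; apply: (proj2 r_fin).
Qed.

End Associativity.

Definition upper (W : lmodType K) (S : int * int -> W) :=
  exists p, forall i, S i != 0 -> shear p i.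

Lemma upper_locfin (W : lmodType K) (S : int * int -> W) :
  upper S -> locfin shear S.
Proof. by move=> [p pS] i; exists (box p i) => a ai /pS; move/mem_box; apply. Qed.

Lemma locfin_col N p : lower shear N -> locfin shear (N ^~ p : _ -> K^o).
Proof. by move=> lN; apply: upper_locfin; exists p => i /lN. Qed.

Definition mulk (A : fps2 K) : kernel := fun i p =>
  fps2_coefz A (i.1 - p.1) (i.2 - p.2).

Definition ser (A : fps2 K) : int * int -> K^o := fun i => fps2_coefz A i.1 i.2.

Lemma ser_neq0 A i : ser A i != 0 -> exists m n : nat, i = (m%:Z, n%:Z).
Proof.
by case: i => [[m|m] [n|n]]; rewrite /ser /= ?eqxx // => _; exists m, n.
Qed.

Lemma ser_inj : injective ser.
Proof.
move=> A B AB; apply/funext => m; apply/funext => n.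
exact: (congr1 (fun S => S (m%:Z, n%:Z)) AB).
Qed.

Lemma lower_mulk A : lower quad (mulk A).
Proof.
move=> [i j] [p q]; rewrite /mulk /quad /= => /(@ser_neq0 A (_, _))[m [n]].
by case=> *; apply/andP; split; lia.
Qed.

Lemma upper_ser A : upper (ser A).
Proof. by exists (0, 0) => i /ser_neq0[m [n ->]]; rewrite /shear /=; lia. Qed.

Lemma fps2_actE (W : lmodType K) A (S : int -> int -> W) i j :
  fps2_act A S i j = act (mulk A) (fun p => S p.1 p.2) (i, j).
Proof.
rewrite /act (@fsum_reindex _ _ _ (fun p : nat * nat => (i - p.1%:Z, j - p.2%:Z))).
- apply: eq_fsum => -[m n] /=; congr (_ *: _).
  by rewrite /mulk /= !subKr.
- by move=> [m n] [m' n'] /= [*]; congr (_, _); lia.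
- move=> [a b]; rewrite scaler_eq0 negb_or => /andP[/(@ser_neq0 A (_, _))[m [n]] /=].
  by case=> *; exists (m, n); congr (_, _); rewrite /=; lia.
Qed.

Lemma act_mulk_ser A B : act (mulk A) (ser B) = ser (fps2_mul A B).
Proof.
apply/funext => -[i j].
have [ij|nij] := boolP ((0 <= i) && (0 <= j)); last first.
  rewrite /act fsum0 => [|p].
    apply/eqP; rewrite eq_sym; apply: contraNT nij => /ser_neq0[m [n [-> ->]]].
    by [].
  apply/eqP; apply: contraNT nij; rewrite scaler_eq0 negb_or => /andP[].
  by move=> /lower_mulk + /ser_neq0[m [n pE]]; rewrite pE /quad /=; lia.
case: i j ij => [i|//] [j|//] _.
rewrite /act (@fsum_reindex _ _ _ (fun p : nat * nat => (i%:Z - p.1%:Z, j%:Z - p.2%:Z))).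
- rewrite (@fsum_pair _ _ _ _ (index_iota 0 i.+1) (index_iota 0 j.+1)); last first.
    move=> a b; rewrite scaler_eq0 negb_or => /andP[_ /ser_neq0[m [n e]]].
    by rewrite !mem_index_iota; case: e => /=; lia.
  rewrite (@fsum_seq _ _ (index_iota 0 i.+1)) ?iota_uniq //; last first.
    move=> a /fsum_neq0[b].
    rewrite scaler_eq0 negb_or => /andP[_ /ser_neq0[m [n e]]].
    by rewrite mem_index_iota; case: e => /=; lia.
  rewrite /ser /fps2_mul big_mkord; apply: eq_bigr => a _.
  rewrite (@fsum_seq _ _ (index_iota 0 j.+1)) ?iota_uniq //; last first.
    move=> b; rewrite scaler_eq0 negb_or => /andP[_ /ser_neq0[m [n e]]].
    by rewrite mem_index_iota; case: e => /=; lia.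
  rewrite big_mkord; apply: eq_bigr => b _.
  rewrite /mulk /= !subKr /=.
  by rewrite !subzn //; [rewrite -ltnS ltn_ord | rewrite -ltnS ltn_ord].
- by move=> [m n] [m' n'] /= [*]; congr (_, _); lia.
- move=> [a b]; rewrite scaler_eq0 negb_or => /andP[/(@ser_neq0 A (_, _))[m [n]] /=].
  by case=> *; exists (m, n); congr (_, _); rewrite /=; lia.
Qed.

End Kernels.

(** * The ring of power series in two variables, read off from matrices *)

Section PowerSeries.
Variable K : fieldType.
Implicit Types A B C : fps2 K.

Local Notation "A ** B" := (fps2_mul A B) (at level 40, left associativity).

Lemma ser_coef A (m n : nat) : ser A (m%:Z, n%:Z) = A m n.
Proof. by []. Qed.

Lemma ser_one i : ser (fps2_one K) i = (i == (0, 0))%:R.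
Proof. by case: i => [[m|m] [n|n]]; rewrite xpair_eqE /= ?andbF. Qed.

Lemma act_mulk1 (W : lmodType K) (S : int * int -> W) :
  act (mulk (fps2_one K)) S = S.
Proof.
apply/funext => i; rewrite /act (fsum1 (j := i)) => [|p pi].
  by rewrite /mulk !subrr scale1r.
have -> : mulk (fps2_one K) i p = ser (fps2_one K) (i.1 - p.1, i.2 - p.2) by [].
case: i p pi => [i j] [p q]; rewrite ser_one !xpair_eqE !subr_eq0 => /negPf.
by rewrite (eq_sym i) (eq_sym j) => ->; rewrite scale0r.
Qed.

(** Multiplication matrices are invariant under translation, so column p reduces to the product of
    two series. *)
Lemma kmul_mulk A B : kmul (mulk A) (mulk B) = mulk (A ** B).
Proof.
apply/funext => -[i j]; apply/funext => -[p q].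
have -> : mulk (A ** B) (i, j) (p, q) = ser (A ** B) (i - p, j - q) by [].
rewrite -act_mulk_ser /kmul /act.
rewrite (@reindex_fsbigT _ _ _ _ _ (fun a : int * int => (a.1 + p, a.2 + q))).
  by apply: eq_fsum => -[a b]; rewrite /mulk /ser /=
    !addrK !opprD !addrA ![_ - a - _]addrAC ![_ - b - _]addrAC.
by exists (fun a => (a.1 - p, a.2 - q)) => -[a b] /=; rewrite ?addrK ?subrK.
Qed.

Lemma act_mulk_mul r (W : lmodType K) A B (S : int * int -> W) :
  finer r -> subrel quad r -> locfin r S ->
  act (mulk (A ** B)) S = act (mulk A) (act (mulk B) S).
Proof.
move=> rf qr lS; rewrite (act_kmul rf) ?kmul_mulk // => i p /lower_mulk; exact: qr.
Qed.

Lemma fps2_mul1 A : A ** fps2_one K = A.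
Proof.
apply: ser_inj; rewrite -act_mulk_ser; apply/funext => i.
rewrite /act (fsum1 (j := (0, 0))) => [|a a0]; last first.
  by rewrite ser_one (negPf a0) scaler0.
by rewrite ser_one eqxx /mulk /= !subr0 /GRing.scale /= mulr1.
Qed.

Lemma fps2_mulC A B : A ** B = B ** A.
Proof.
apply: ser_inj; rewrite -!act_mulk_ser; apply/funext => -[i j]; rewrite /act.
rewrite (@reindex_fsbigT _ _ _ _ _ (fun a : int * int => (i - a.1, j - a.2))).
  by apply: eq_fsum => a; rewrite /mulk /ser /= !subKr /GRing.scale /= mulrC.
by exists (fun a : int * int => (i - a.1, j - a.2)) => -[a b] /=; rewrite !subKr.
Qed.

Lemma fps2_mulA A B C : A ** (B ** C) = A ** B ** C.
Proof.
apply: ser_inj; rewrite -!act_mulk_ser -kmul_mulk (act_kmul finer_shear) //.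
- exact/lower_quad/lower_mulk.
- exact/lower_quad/lower_mulk.
- exact/upper_locfin/upper_ser.
Qed.

Lemma fps2_expM A B n : fps2_exp (A ** B) n = fps2_exp A n ** fps2_exp B n.
Proof.
elim: n => [|n IHn]; first by rewrite [RHS]fps2_mul1.
rewrite [LHS]/= -/(fps2_exp _ n) IHn -!fps2_mulA; congr (_ ** _).
by rewrite !fps2_mulA (fps2_mulC B).
Qed.

Lemma act_sub r N (W : lmodType K) (S T : int * int -> W) :
  lower r N -> locfin r S -> locfin r T ->
  act N (fun i => S i - T i) = fun i => act N S i - act N T i.
Proof.
move=> lN lS lT; apply/funext => i; have [s sP] := lS i; have [t tP] := lT i.
have opp : - act N T i = \sum_(a \in [set: int * int]) - (N i a *: T a).
  by rewrite -scaleN1r scale_fsumr; apply: eq_fsum => a; rewrite scaleN1r.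
rewrite opp /act -(@fsum_add _ _ (s ++ t)).
- by apply: eq_fsum => a; rewrite scalerBr.
- move=> a; rewrite scaler_eq0 negb_or mem_cat => /andP[/lN ai /sP].
  by move=> /(_ ai) ->.
- move=> a; rewrite oppr_eq0 scaler_eq0 negb_or mem_cat => /andP[/lN ai /tP].
  by move=> /(_ ai) ->; rewrite orbT.
Qed.

(* [x^c y^d] is the smallest monomial of [A] for the lexicographic order that
   compares the exponents of [y] first. *)
Definition monic_at A (c d : nat) :=
  A c d = 1 /\ (forall m n, (n < d)%N || (n == d) && (m < c)%N -> A m n = 0).

(** Induction on the row and, within a row, on the column. Once D vanishes in all lower rows and to
    the left of (i, j), the coefficient of x^(i+c) y^(j+d) in the product is D (i, j) alone. *)
Lemma mulk_inj A c d (D : int * int -> K^o) :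
  monic_at A c d -> upper D -> (forall i, act (mulk A) D i = 0) ->
  forall i, D i = 0.
Proof.
move=> [Acd A0] [p Dp] AD [i j].
have rows (n : nat) : forall i j, j < p.2 + n%:Z -> D (i, j) = 0.
  elim: n => [|n IHn] {}i {}j jn.
    by apply/eqP; apply: contraLR jn => /Dp; rewrite /shear /=; lia.
  (* In row j, the condition [shear p (i, j)] gives i >= p.1 + 2 p.2 - 2 j on the support of D; the
     inner induction starts from this bound. *)
  have cols (m : nat) : forall i, i < p.1 + 2 * p.2 - 2 * j + m%:Z -> D (i, j) = 0.
    elim: m => [|m IHm] {}i im.
      by apply/eqP; apply: contraLR im => /Dp; rewrite /shear /=; lia.
    have := AD (i + c%:Z, j + d%:Z); rewrite /act (fsum1 (j := (i, j))).
      by rewrite /mulk /= ![_ + _ - _]addrAC !subrr !add0r /= Acd scale1r.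
    move=> [a b] ab; apply/eqP; apply: contraNT ab.
    rewrite scaler_eq0 negb_or => /andP[].
    have -> : mulk A (i + c%:Z, j + d%:Z) (a, b) =
              ser A (i + c%:Z - a, j + d%:Z - b) by [].
    move=> /[dup] /ser_neq0[x [y [xE yE]]]; rewrite xE yE ser_coef => Axy Dab.
    have bj : j <= b.
      rewrite leNgt; apply: contra Dab => bj; rewrite IHn //; lia.
    have ai : b = j -> i <= a.
      move=> bE; rewrite leNgt; apply: contra Dab => ai; rewrite bE IHm //; lia.
    have : ~~ ((y < d)%N || (y == d) && (x < c)%N).
      by apply: contra Axy => /A0 ->.
    by rewrite xpair_eqE; lia.
  by apply: (cols (`|(i - (p.1 + 2 * p.2 - 2 * j))%R|.+1)%N); lia.
by apply: (rows (`|(j - p.2)%R|.+1)%N); lia.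
Qed.

End PowerSeries.

(** * Substitutions *)

Section Substitutions.
Variable K : fieldType.
Implicit Types (A B X Y : fps2 K) (Q : kernel K).

Local Notation "A ** B" := (fps2_mul A B) (at level 40, left associativity).

(* The matrix of a substitution x -> X(x,y), y -> Y(x,y) of doubly infinite
   series; its column [p] is X^p.1 Y^p.2, also for negative exponents. *)
Record subst_kernel Q X Y : Prop := SubstKernel {
  subst_lower : lower shear Q;
  subst_one : forall i, Q i (0, 0) = (i == (0, 0))%:R;
  subst_mulX : forall p,
    act (mulk X) (Q ^~ p : _ -> K^o) = Q ^~ (p.1 + 1, p.2);
  subst_mulY : forall p,
    act (mulk Y) (Q ^~ p : _ -> K^o) = Q ^~ (p.1, p.2 + 1) }.

(** Keeping only nonnegative exponents loses nothing, by [ser_subst]. *)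
Definition subst_fps2 Q A : fps2 K := fun m n => act Q (ser A) (m%:Z, n%:Z).

Section OneSubstitution.
Variables (Q : kernel K) (X Y : fps2 K) (sQ : subst_kernel Q X Y).
Let lQ := subst_lower sQ.

Let fcol p : locfin shear (Q ^~ p : _ -> K^o). Proof. exact: locfin_col. Qed.
Let qs : subrel quad shear := proj2 finer_quad.

Lemma subst_expX p (c : nat) :
  act (mulk (fps2_exp X c)) (Q ^~ p : _ -> K^o) = Q ^~ (p.1 + c%:Z, p.2).
Proof.
elim: c => [|c IHc]; first by rewrite act_mulk1 addr0 -surjective_pairing.
rewrite (act_mulk_mul _ _ finer_shear) // IHc (subst_mulX sQ) /=.
by have -> : p.1 + c%:Z + 1 = p.1 + c.+1%:Z by lia.
Qed.

Lemma subst_expY p (c : nat) :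
  act (mulk (fps2_exp Y c)) (Q ^~ p : _ -> K^o) = Q ^~ (p.1, p.2 + c%:Z).
Proof.
elim: c => [|c IHc]; first by rewrite act_mulk1 addr0 -surjective_pairing.
rewrite (act_mulk_mul _ _ finer_shear) // IHc (subst_mulY sQ) /=.
by have -> : p.2 + c%:Z + 1 = p.2 + c.+1%:Z by lia.
Qed.

Lemma subst_expXY p (c d : nat) :
  act (mulk (fps2_exp X c ** fps2_exp Y d)) (Q ^~ p : _ -> K^o) =
  Q ^~ (p.1 + c%:Z, p.2 + d%:Z).
Proof. by rewrite (act_mulk_mul _ _ finer_shear) // subst_expY subst_expX. Qed.

(** Column (0,0) is the series 1, and multiplying it by X and Y reaches every column of nonnegative
    index. *)
Lemma subst_col (c d : nat) :
  Q ^~ (c%:Z, d%:Z) = ser (fps2_exp X c ** fps2_exp Y d).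
Proof.
rewrite -[fps2_exp X c ** _]fps2_mul1 -act_mulk_ser.
have -> : ser (fps2_one K) = (Q ^~ (0, 0) : _ -> K^o).
  by apply/funext => i; rewrite ser_one (subst_one sQ).
by rewrite subst_expXY !add0r.
Qed.

Lemma ser_subst A : ser (subst_fps2 Q A) = act Q (ser A).
Proof.
apply/funext => i.
suff : act Q (ser A) i != 0 -> exists m n : nat, i = (m%:Z, n%:Z).
  case: eqVneq => [Qi _|_ /(_ isT)[m [n ->]] //].
  have [->|/ser_neq0[m [n iE]]] := eqVneq (ser (subst_fps2 Q A) i) 0;
    first by rewrite Qi.
  by rewrite iE.
move=> /fsum_neq0[a]; rewrite scaler_eq0 negb_or => /andP[].
move=> + /ser_neq0[c [d aE]]; rewrite aE.
have -> : Q i (c%:Z, d%:Z) = ser (fps2_exp X c ** fps2_exp Y d) i.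
  by rewrite -subst_col.
exact: ser_neq0.
Qed.

(** This is multiplicativity of substitution, including on series with negative exponents. *)
Lemma subst_mulk A : kmul Q (mulk A) = kmul (mulk (subst_fps2 Q A)) Q.
Proof.
apply/funext => i; apply/funext => p; rewrite /kmul.
rewrite (@reindex_fsbigT _ _ _ _ _ (fun a : int * int => (p.1 + a.1, p.2 + a.2)));
  last first.
  by exists (fun a => (a.1 - p.1, a.2 - p.2)) => -[a b] /=; congr (_, _); lia.
(* Column p + a is X^a.1 Y^a.2 times column p, and X^a.1 Y^a.2 is itself column a, since only
   nonnegative a occur in the support of A. *)
have lhs a : Q i (p.1 + a.1, p.2 + a.2) * mulk A (p.1 + a.1, p.2 + a.2) p =
    \sum_(b \in [set: int * int])
      Q (i.1 - b.1, i.2 - b.2) a * ser A a * Q b p.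
  have -> : mulk A (p.1 + a.1, p.2 + a.2) p = ser A a.
    by rewrite /mulk /ser /= ![_ + _ - _]addrAC !subrr !add0r.
  have [->|/ser_neq0[c [d aE]]] := eqVneq (ser A a) 0.
    by rewrite mulr0 fsum0 // => b; rewrite mulr0 mul0r.
  rewrite aE.
  have -> : Q i (p.1 + c%:Z, p.2 + d%:Z) =
      act (mulk (fps2_exp X c ** fps2_exp Y d)) (Q ^~ p : _ -> K^o) i.
    by rewrite subst_expXY.
  rewrite /act mulrC mulr_fsumr; apply: eq_fsum => b.
  have -> : Q (i.1 - b.1, i.2 - b.2) (c%:Z, d%:Z) =
      ser (fps2_exp X c ** fps2_exp Y d) (i.1 - b.1, i.2 - b.2).
    by rewrite -subst_col.
  by rewrite mulrA [ser A _ * _]mulrC.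
under eq_fsum do rewrite lhs.
(* For [shear], nonzero terms satisfy p <= b and 0 <= a <= i - b, hence b <= i and a <= i - p. *)
rewrite (@fsum_exchange _ _ _ _ (box (0, 0) (i.1 - p.1, i.2 - p.2)) (box p i)).
  apply: eq_fsum => b; rewrite -mulr_fsuml.
  have -> : mulk (subst_fps2 Q A) i b =
            ser (subst_fps2 Q A) (i.1 - b.1, i.2 - b.2) by [].
  by rewrite ser_subst.
move=> a b; rewrite !mulf_eq0 !negb_or -andbA => /and3P[/lQ + + /lQ].
move=> ai /ser_neq0[c [d aE]] pb; move: ai pb; rewrite aE /shear /= => ai pb.
by apply/andP; split; apply: mem_box; rewrite /shear /=; lia.
Qed.

Lemma act_subst_mulk r (W : lmodType K) A (S : int * int -> W) :
  finer r -> subrel quad r -> lower r Q -> locfin r S ->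
  act Q (act (mulk A) S) = act (mulk (subst_fps2 Q A)) (act Q S).
Proof.
move=> rf qr lrQ lS.
have lm B : lower r (mulk B) by move=> i p /lower_mulk; apply: qr.
by rewrite (act_kmul rf) // (act_kmul rf) // subst_mulk.
Qed.

Lemma subst_fps2_mul A B :
  subst_fps2 Q (A ** B) = subst_fps2 Q A ** subst_fps2 Q B.
Proof.
apply: ser_inj; rewrite ser_subst -!act_mulk_ser ser_subst.
by rewrite (act_subst_mulk _ finer_shear) //; apply/upper_locfin/upper_ser.
Qed.

Lemma subst_fps2_one : subst_fps2 Q (fps2_one K) = fps2_one K.
Proof.
apply: ser_inj; rewrite ser_subst; apply/funext => i.
rewrite /act (fsum1 (j := (0, 0))) => [|a a0].
  by rewrite !ser_one eqxx (subst_one sQ) /GRing.scale /= mulr1.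
by rewrite ser_one (negPf a0) scaler0.
Qed.

Lemma subst_fps2_exp A n :
  subst_fps2 Q (fps2_exp A n) = fps2_exp (subst_fps2 Q A) n.
Proof.
elim: n => [|n IHn]; first exact: subst_fps2_one.
by rewrite [fps2_exp _ _]/= subst_fps2_mul IHn.
Qed.

Lemma ser_x i : ser (@fps2_x K) i = (i == (1, 0))%:R.
Proof. by case: i => [[m|m] [n|n]]; rewrite xpair_eqE /= ?andbF. Qed.

Lemma ser_y i : ser (@fps2_y K) i = (i == (0, 1))%:R.
Proof. by case: i => [[m|m] [n|n]]; rewrite xpair_eqE /= ?andbF. Qed.

Lemma subst_fps2_x : subst_fps2 Q fps2_x = X.
Proof.
apply: ser_inj; rewrite ser_subst; apply/funext => i.
rewrite /act (fsum1 (j := (1, 0))) => [|a a0]; last first.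
  by rewrite ser_x (negPf a0) scaler0.
rewrite ser_x eqxx /GRing.scale /= mulr1.
have /(congr1 (fun S => S i)) /= -> := subst_col 1 0.
by rewrite fps2_mul1 fps2_mul1.
Qed.

Lemma subst_fps2_y : subst_fps2 Q fps2_y = Y.
Proof.
apply: ser_inj; rewrite ser_subst; apply/funext => i.
rewrite /act (fsum1 (j := (0, 1))) => [|a a0]; last first.
  by rewrite ser_y (negPf a0) scaler0.
rewrite ser_y eqxx /GRing.scale /= mulr1.
have /(congr1 (fun S => S i)) /= -> := subst_col 0 1.
by rewrite fps2_mulC !fps2_mul1.
Qed.

Lemma subst_fps2_add A B :
  subst_fps2 Q (fps2_add A B) = fps2_add (subst_fps2 Q A) (subst_fps2 Q B).
Proof.
apply/funext => m; apply/funext => n; rewrite /fps2_add /subst_fps2 /act.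
rewrite -(@fsum_add _ _ (box (0, 0) (m%:Z, n%:Z))) => [|a|a].
- apply: eq_fsum => a; rewrite /GRing.scale /= -mulrDr; congr (_ * _).
  by case: a => [[a|a] [b|b]]; rewrite /ser /= ?addr0.
- rewrite /GRing.scale /= mulf_eq0 negb_or => /andP[/lQ ai /ser_neq0[c [d aE]]].
  by move: ai; rewrite aE => ai; apply: mem_box; rewrite // /shear /=; lia.
- rewrite /GRing.scale /= mulf_eq0 negb_or => /andP[/lQ ai /ser_neq0[c [d aE]]].
  by move: ai; rewrite aE => ai; apply: mem_box; rewrite // /shear /=; lia.
Qed.

Lemma subst_fps2_sub A B :
  subst_fps2 Q (fps2_sub A B) = fps2_sub (subst_fps2 Q A) (subst_fps2 Q B).
Proof.
have {2}-> : A = fps2_add (fps2_sub A B) B.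
  by apply/funext => m; apply/funext => n; rewrite /fps2_add /fps2_sub subrK.
rewrite subst_fps2_add; apply/funext => m; apply/funext => n.
by rewrite /fps2_add /fps2_sub addrK.
Qed.

End OneSubstitution.

(** Column p of the product is Q applied to column p of Q', and Q turns multiplication by X' into
    multiplication by the image of X'. *)
Lemma subst_comp Q X Y Q' X' Y' :
  subst_kernel Q X Y -> subst_kernel Q' X' Y' ->
  subst_kernel (kmul Q Q') (subst_fps2 Q X') (subst_fps2 Q Y').
Proof.
move=> sQ sQ'; have [lQ lQ'] := (subst_lower sQ, subst_lower sQ').
have kE p : (kmul Q Q' ^~ p : _ -> K^o) = act Q (Q' ^~ p : _ -> K^o) by [].
split=> [|i|p|p].
- exact: (lower_kmul finer_shear).
- rewrite /kmul (fsum1 (j := (0, 0))) => [|a a0]; rewrite !(subst_one sQ').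
    by rewrite eqxx mulr1 (subst_one sQ).
  by rewrite (negPf a0) mulr0.
- rewrite kE -(act_subst_mulk sQ _ finer_shear) ?(subst_mulX sQ') //.
    exact: (proj2 finer_quad).
  exact: locfin_col.
- rewrite kE -(act_subst_mulk sQ _ finer_shear) ?(subst_mulY sQ') //.
    exact: (proj2 finer_quad).
  exact: locfin_col.
Qed.

Lemma subst_uniq Q Q' X Y :
  monic_at X 1 0 -> monic_at Y 0 1 ->
  subst_kernel Q X Y -> subst_kernel Q' X Y -> Q = Q'.
Proof.
move=> mX mY sQ sQ'; have [lQ lQ'] := (subst_lower sQ, subst_lower sQ').
have lm A : lower shear (mulk A) by apply/lower_quad/lower_mulk.
(* Columns p agree exactly when their multiples by A agree: the difference of the two columns is
   bounded below by p, so [mulk_inj] applies to it. *)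
have diff A c d p p' : monic_at A c d ->
    act (mulk A) (Q ^~ p : _ -> K^o) = Q ^~ p' ->
    act (mulk A) (Q' ^~ p : _ -> K^o) = Q' ^~ p' ->
    (Q ^~ p =1 Q' ^~ p) <-> (Q ^~ p' =1 Q' ^~ p').
  move=> mA <- <-; split=> [/funext -> //|eqA i].
  apply/eqP; rewrite -subr_eq0; apply/eqP.
  apply: (mulk_inj (D := fun i => (Q i p : K^o) - Q' i p) mA).
    exists p => {}i; apply: contraR => npi.
    rewrite (contraNeq (@lQ i p)) ?(contraNeq (@lQ' i p)) ?subrr //.
  move=> {}i; rewrite (act_sub (r := shear)) //; last 2 first.
  - exact: locfin_col.
  - exact: locfin_col.
  by rewrite eqA subrr.
have eqX p q : (Q ^~ (p, q) =1 Q' ^~ (p, q)) <->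
               (Q ^~ (p + 1, q) =1 Q' ^~ (p + 1, q)).
  by apply: (diff _ _ _ (p, q) (p + 1, q) mX);
    rewrite ?(subst_mulX sQ) ?(subst_mulX sQ').
have eqY p q : (Q ^~ (p, q) =1 Q' ^~ (p, q)) <->
               (Q ^~ (p, q + 1) =1 Q' ^~ (p, q + 1)).
  by apply: (diff _ _ _ (p, q) (p, q + 1) mY);
    rewrite ?(subst_mulY sQ) ?(subst_mulY sQ').
have col p q : Q ^~ (p, q) =1 Q' ^~ (p, q).
  (* Starting at (0,0), the forward implications reach positive indices and the converse ones, which
     rest on injectivity, reach negative indices. *)
  elim/int_rect: p => [|n IHn|n IHn].
  - elim/int_rect: q => [|n IHn|n IHn];
      first by move=> i; rewrite (subst_one sQ) (subst_one sQ').
      by rewrite intS addrC; exact: (proj1 (eqY _ _) IHn).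
    by apply: (proj2 (eqY _ _)); rewrite -addn1 PoszD opprD addrNK.
  - by rewrite intS addrC; exact: (proj1 (eqX _ _) IHn).
  - by apply: (proj2 (eqX _ _)); rewrite -addn1 PoszD opprD addrNK.
by apply/funext => i; apply/funext => -[p q]; apply: col.
Qed.

End Substitutions.

(** * Integer powers of series and the substitutions they define *)

Section Powers.
Variable K : fieldType.
Implicit Types (A B D : fps2 K) (h : fps1 K).

Local Notation "A ** B" := (fps2_mul A B) (at level 40, left associativity).

Lemma binz0 m : binz K m 0 = 1.
Proof. by case: m => n; rewrite /= bin0 ?expr0 ?mul1r. Qed.

Lemma binzS (m : int) k : binz K (m + 1) k.+1 = binz K m k.+1 + binz K m k.
Proof.
case: m => [n|[|n]].
- have -> : Posz n + 1 = Posz n.+1 by lia.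
  by rewrite /= binS natrD.
(* For m = -1 the sum m + 1 passes from [Negz] to [Posz]. *)
- have -> : Negz 0 + 1 = 0 by [].
  by rewrite /= !add0n !binn exprS !mulr1 mulN1r addNr bin0n.
- have -> : Negz n.+1 + 1 = Negz n by rewrite !NegzE; lia.
  rewrite /= [(n.+1 + k.+1)%N]addnS binS natrD mulrDr addnS -addSn exprS.
  by rewrite !mulN1r !mulNr subrK.
Qed.

Lemma act_mulk_shift (W : lmodType K) A c d (S : int * int -> W) i :
  (forall m n, A m n = ((m == c) && (n == d))%:R) ->
  act (mulk A) S i = S (i.1 - c%:Z, i.2 - d%:Z).
Proof.
move=> AE; rewrite /act (fsum1 (j := (i.1 - c%:Z, i.2 - d%:Z))) => [|[a b] ab].
  by rewrite /mulk /= !subKr /= AE !eqxx scale1r.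
apply/eqP; apply: contraNT ab; rewrite scaler_eq0 negb_or => /andP[].
have -> : mulk A i (a, b) = ser A (i.1 - a, i.2 - b) by [].
move=> /[dup] /ser_neq0[m [n [mE nE]]]; rewrite mE nE ser_coef AE xpair_eqE.
by case: (eqVneq m c) => [mc|]; case: (eqVneq n d) => [nd|] //=; rewrite ?eqxx //; lia.
Qed.

Lemma act_mulk_add r (W : lmodType K) A B (S : int * int -> W) :
  subrel quad r -> locfin r S ->
  act (mulk (fps2_add A B)) S = fun i => act (mulk A) S i + act (mulk B) S i.
Proof.
move=> qr lS; apply/funext => i; have [s sP] := lS i.
have bound (C : fps2 K) a : mulk C i a *: S a != 0 -> a \in s.
  by rewrite scaler_eq0 negb_or => /andP[/lower_mulk/qr ai]; apply: sP.
rewrite /act -(fsum_add (bound A) (bound B)); apply: eq_fsum => a.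
rewrite -scalerDl; congr (_ *: _); rewrite /mulk.
by case: (i.1 - a.1) (i.2 - a.2) => [m|m] [n|n]; rewrite /= ?addr0.
Qed.

Lemma ser_mul_translate A B (i s : int * int) :
  ser (A ** B) (i.1 - s.1, i.2 - s.2) =
  \sum_(a \in [set: int * int]) mulk A i a * ser B (a.1 - s.1, a.2 - s.2).
Proof.
rewrite -act_mulk_ser /act.
rewrite (@reindex_fsbigT _ _ _ _ _ (fun a : int * int => (a.1 - s.1, a.2 - s.2))).
  apply: eq_fsum => a; rewrite /GRing.scale /=; congr (_ * _).
  by rewrite /mulk /=; congr (fps2_coefz A _ _); lia.
exists (fun a => (a.1 + s.1, a.2 + s.2)) => -[a b] /=; congr (_, _); lia.
Qed.

(** Every monomial of D^(k+1) is a monomial of D^k times one of D. This yields the weight bounds as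
    well as the absence of y in powers of h(x) - x. *)
Lemma ser_exp_ind (P : nat -> int * int -> Prop) D :
  P 0%N (0, 0) ->
  (forall k a (m n : nat), P k a -> D m n != 0 -> P k.+1 (a.1 + m%:Z, a.2 + n%:Z)) ->
  forall k i, ser (fps2_exp D k) i != 0 -> P k i.
Proof.
move=> P0 PS; elim=> [|k IHk] i.
  by rewrite ser_one; have [-> //|_] := eqVneq i (0, 0); rewrite eqxx.
rewrite [fps2_exp _ _]/= -/(fps2_exp _ _) -act_mulk_ser => /fsum_neq0[a].
rewrite scaler_eq0 negb_or => /andP[Da /IHk Pa].
have := Da; have -> : mulk D i a = ser D (i.1 - a.1, i.2 - a.2) by [].
move=> /[dup] /ser_neq0[m [n [mE nE]]]; rewrite mE nE ser_coef => Dmn.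
have -> : i = (a.1 + m%:Z, a.2 + n%:Z)
  by rewrite -mE -nE ![_ + (_ - _)]addrC !subrK -surjective_pairing.
exact: PS.
Qed.

Section OneVariable.
Variables (A : fps2 K) (A00 : A 0%N 0%N = 0) (A10 : A 1%N 0%N = 1).
Let D := fps2_sub A fps2_x.

(* With [x] of weight 1 and [y] of weight 2, every monomial of [A - x] has
   weight at least 2; this bounds the sum defining [fps2_expz]. *)
Lemma exp_weight k i : ser (fps2_exp D k) i != 0 ->
  [&& 0 <= i.1, 0 <= i.2 & 2 * k%:Z <= i.1 + 2 * i.2].
Proof.
apply: (@ser_exp_ind (fun k i => is_true
  [&& 0 <= i.1, 0 <= i.2 & 2 * k%:Z <= i.1 + 2 * i.2])) => //.
move=> {}k a m n /and3P[? ? ?] Dmn /=.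
suff : (2 <= m + 2 * n)%N by lia.
rewrite leqNgt; apply: contra Dmn; case: n => [|n]; last by lia.
case: m => [|[|m]] //; first by rewrite /D /fps2_sub A00 subr0.
by rewrite /D /fps2_sub A10 subrr.
Qed.

Lemma expzE m i j : fps2_expz A m i j =
  \sum_(k \in [set: nat]) binz K m k * ser (fps2_exp D k) (i - m + k%:Z, j).
Proof. by []. Qed.

(** The k-th term needs a monomial of (A - x)^k of weight i - m + k + 2j, and this weight is at
    least 2k; hence 0 <= k <= i - m + 2j. *)
Lemma expz_neq0 m i j : fps2_expz A m i j != 0 -> (0 <= j) && (m <= i + 2 * j).
Proof.
rewrite expzE => /fsum_neq0[k]; rewrite mulf_eq0 negb_or => /andP[_].
by move=> /exp_weight /=; lia.
Qed.

(** Write A = x + D. In A A^m the power D^k receives binom(m,k) from x A^m and binom(m,k-1) from D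
    A^m; Pascal's rule adds them up. *)
Lemma expz_mul m (i : int * int) q :
  \sum_(a \in [set: int * int]) mulk A i a * fps2_expz A m a.1 (a.2 - q) =
  fps2_expz A (m + 1) i.1 (i.2 - q).
Proof.
pose S (a : int * int) : K^o := fps2_expz A m a.1 (a.2 - q).
have lS : locfin shear S.
  move=> j; exists (box (m, q) j) => a aj /expz_neq0 am.
  by apply: mem_box => //; rewrite /shear /=; lia.
have -> : \sum_(a \in [set: int * int]) mulk A i a * fps2_expz A m a.1 (a.2 - q)
    = act (mulk A) S i by [].
have AE : A = fps2_add fps2_x D.
  by apply/funext => x; apply/funext => y; rewrite /fps2_add /D /fps2_sub addrC subrK.
rewrite {1}AE (act_mulk_add _ _ (proj2 finer_quad)) // (@act_mulk_shift _ _ 1 0) // /S /=.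
(* By the weight estimate, a nonzero term with D^k has k at most N. *)
pose N := `|(i.1 - m + 2 * (i.2 - q))%R|%N.
have -> : act (mulk D) S i =
    \sum_(k \in [set: nat])
      binz K m k * ser (fps2_exp D k.+1) (i.1 - m + k%:Z, i.2 - q).
  rewrite /act /S; under eq_fsum => a do rewrite expzE /GRing.scale /= mulr_fsumr.
  rewrite (@fsum_exchange _ _ _ _ (box (m, q) i) (index_iota 0 N.+1)) => [|a k].
    apply: eq_fsum => k.
    have -> : (i.1 - m + k%:Z, i.2 - q) =
        (i.1 - (m - k%:Z, q).1, i.2 - (m - k%:Z, q).2).
      by congr (_, _); rewrite /=; lia.
    rewrite [fps2_exp _ _]/= -/(fps2_exp _ _) ser_mul_translate mulr_fsumr.
    apply: eq_fsum => a; rewrite mulrCA; congr (_ * (_ * _)).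
    by congr (ser _ (_, _)); rewrite /=; lia.
  rewrite !mulf_eq0 !negb_or => /and3P[/lower_mulk + _ /exp_weight].
  rewrite /quad /= => ? ?; apply/andP; split; last by rewrite mem_index_iota; lia.
  by apply: mem_box; rewrite /shear /=; lia.
(* The terms of D A^m, reindexed by the exponent of D; there is none for exponent 0. *)
pose G k := if k is k'.+1 then
  binz K m k' * ser (fps2_exp D k) (i.1 - (m + 1) + k%:Z, i.2 - q) else 0.
have -> : \sum_(k \in [set: nat])
      binz K m k * ser (fps2_exp D k.+1) (i.1 - m + k%:Z, i.2 - q) = \sum_(k \in [set: nat]) G k.
  rewrite [RHS](@fsum_reindex _ _ _ succn) => [|? ? []//|[|k]]; last 2 first.
  - by rewrite eqxx.
  - by exists k.
  by apply: eq_fsum => k /=; congr (_ * ser _ (_, _)); lia.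
rewrite !expzE -(@fsum_add _ _ (index_iota 0 N.+2)).
- apply: eq_fsum => -[|k]; rewrite /G.
    by rewrite !binz0 !mul1r addr0; congr (ser _ (_, _)); lia.
  by rewrite binzS mulrDl; congr (_ * ser _ (_, _) + _); lia.
- move=> k; rewrite mulf_eq0 negb_or => /andP[_ /exp_weight /= ?].
  by rewrite mem_index_iota; lia.
- move=> [|k]; rewrite /G ?eqxx // mulf_eq0 negb_or => /andP[_ /exp_weight /= ?].
  by rewrite mem_index_iota; lia.
Qed.

Definition substx : kernel K := fun i p => fps2_expz A p.1 i.1 (i.2 - p.2).

Lemma substx_kernel : subst_kernel substx A fps2_y.
Proof.
split=> [i p|i|p|p].
- by move=> /expz_neq0; rewrite /shear; lia.
- rewrite /substx expzE (fsum1 (j := 0%N)) => [|[|k] k0]; last by rewrite mul0r.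
    rewrite binz0 mul1r ser_one; congr (_ == _)%:R.
    by case: i => [a b]; congr (_, _); rewrite /=; lia.
  by rewrite eqxx in k0.
- by apply/funext => i; apply: expz_mul.
- apply/funext => i; rewrite (@act_mulk_shift _ _ 0 1) // /substx /= subr0.
  by congr (fps2_expz _ _ _ _); lia.
Qed.

Lemma monic_at_x : monic_at A 1 0.
Proof. by split=> // m [|n] //=; case: m => [|[|]]. Qed.

End OneVariable.

Section Univariate.
Variables (h : fps1 K) (h0 : h 0%N = 0) (h1 : h 1%N = 1).

Lemma fps_in_xE m i j :
  fps2_expz (fps_in_x h) m i j = if j == 0 then fps1_expz h m i else 0.
Proof.
case: eqVneq => [-> //|j0]; rewrite expzE fsum0 // => k.
apply/eqP; rewrite mulf_eq0; apply/orP; right; apply: contraNT j0.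
move=> /(@ser_exp_ind (fun k i => is_true (i.2 == 0))) /=; apply=> // _ a c d /eqP ->.
by case: d => // d; rewrite /fps2_sub /fps_in_x /fps2_x andbF subrr eqxx.
Qed.

Lemma fps1_expz_neq0 m i : fps1_expz h m i != 0 -> m <= i.
Proof. by move=> /(expz_neq0 (A := fps_in_x h) h0 h1); lia. Qed.

Lemma fps1_expz0 i : fps1_expz h 0 i = (i == 0)%:R.
Proof.
have := subst_one (substx_kernel (A := fps_in_x h) h0 h1) (i, 0).
by rewrite /substx xpair_eqE /= subr0 andbT.
Qed.

Lemma fps1_expz_mul m i :
  \sum_(a \in [set: int]) ser (fps_in_x h) (i - a, 0) * fps1_expz h m a =
  fps1_expz h (m + 1) i.
Proof.
have := expz_mul (A := fps_in_x h) h0 h1 m (i, 0) 0; rewrite subr0 /= => eqm.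
rewrite -[RHS]eqm => {eqm}.
rewrite (@fsum_reindex _ _ _ (fun a : int => (a, 0))) => [|a b []//|[a b]].
  by apply: eq_fsum => a; rewrite /mulk /= !subr0.
rewrite fps_in_xE mulf_eq0 negb_or subr0 /= => /andP[_].
by case: ifP => [/eqP -> _|_]; [exists a | rewrite eqxx].
Qed.

Definition substxy : kernel K := fun i p =>
  fps1_expz h p.1 i.1 * fps1_expz h p.2 i.2.

Lemma lower_substxy : lower quad substxy.
Proof.
move=> i p; rewrite mulf_eq0 negb_or => /andP[/fps1_expz_neq0 ? /fps1_expz_neq0 ?].
exact/andP.
Qed.

Lemma substxy_kernel : subst_kernel substxy (fps_in_x h) (fps_in_y h).
Proof.
split=> [|i|p|p].
- exact/lower_quad/lower_substxy.
- by rewrite /substxy !fps1_expz0 -natrM mulnb.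
- apply/funext => i; rewrite /act.
  rewrite (@fsum_reindex _ _ _ (fun a : int => (a, i.2))) => [|a b []//|[a b]].
    rewrite /substxy -fps1_expz_mul mulr_fsuml; apply: eq_fsum => a.
    by rewrite /mulk /GRing.scale /= subrr mulrA.
  rewrite scaler_eq0 negb_or => /andP[+ _].
  have -> : mulk (fps_in_x h) i (a, b) = ser (fps_in_x h) (i.1 - a, i.2 - b) by [].
  move=> /[dup] /ser_neq0[m [n [mE nE]]]; rewrite mE nE ser_coef /fps_in_x.
  case: n nE => [nE _|n]; last by rewrite eqxx.
  by exists a; congr (_, _); lia.
- apply/funext => i; rewrite /act.
  rewrite (@fsum_reindex _ _ _ (fun a : int => (i.1, a))) => [|a b []//|[a b]].
    rewrite /substxy -fps1_expz_mul mulr_fsumr; apply: eq_fsum => a.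
    rewrite /mulk /GRing.scale /= subrr mulrCA; congr (_ * _).
  rewrite scaler_eq0 negb_or => /andP[+ _].
  have -> : mulk (fps_in_y h) i (a, b) = ser (fps_in_y h) (i.1 - a, i.2 - b) by [].
  move=> /[dup] /ser_neq0[m [n [mE nE]]]; rewrite mE nE ser_coef /fps_in_y.
  case: m mE => [mE _|m]; last by rewrite eqxx.
  by exists b; congr (_, _); lia.
Qed.

Lemma monic_at_in_y : monic_at (fps_in_y h) 0 1.
Proof. by split=> // -[|m] [|[|n]]. Qed.

End Univariate.
End Powers.

(** * Compositional inverses *)

Section Inverse.
Variable K : fieldType.
Implicit Types (A B : fps2 K) (g h : fps1 K) (N M Q : kernel K).

Local Notation "A ** B" := (fps2_mul A B) (at level 40, left associativity).

Lemma kmulA Q N M : lower shear Q -> lower shear N -> lower shear M ->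
  kmul Q (kmul N M) = kmul (kmul Q N) M.
Proof.
move=> lQ lN lM; apply/funext => i; apply/funext => p.
have := act_kmul finer_shear lQ lN (@locfin_col _ _ p lM).
exact: (congr1 (fun S => S i)).
Qed.

Lemma kmul1k N : kmul (mulk (fps2_one K)) N = N.
Proof.
apply/funext => i; apply/funext => p.
exact: (congr1 (fun S => S i) (act_mulk1 (N ^~ p : _ -> K^o))).
Qed.

Lemma kmulk1 N : kmul N (mulk (fps2_one K)) = N.
Proof.
apply/funext => i; apply/funext => p; rewrite /kmul.
have mE a : mulk (fps2_one K) a p = (a == p)%:R.
  have -> : mulk (fps2_one K) a p = ser (fps2_one K) (a.1 - p.1, a.2 - p.2) by [].
  by rewrite ser_one xpair_eqE !subr_eq0; case: a p => [? ?] [? ?].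
rewrite (fsum1 (j := p)) => [|a ap]; first by rewrite mE eqxx mulr1.
by rewrite mE (negPf ap) mulr0.
Qed.

Lemma identity_kernel : subst_kernel (mulk (fps2_one K)) fps2_x fps2_y.
Proof.
split=> [|i|p|p].
- exact/lower_quad/lower_mulk.
- by rewrite -ser_one /mulk /ser /= !subr0.
- apply/funext => i; rewrite (@act_mulk_shift _ _ _ 1 0) // /mulk /=.
  by congr (fps2_coefz _ _ _); lia.
- apply/funext => i; rewrite (@act_mulk_shift _ _ _ 0 1) // /mulk /=.
  by congr (fps2_coefz _ _ _); lia.
Qed.

(** Iterating [step] k times from any function fixes the values at all n < k, so the diagonal of the
    iterates is the required function. *)
Lemma course_of_values (T : Type) (t0 : T) (step : nat -> (nat -> T) -> T) :
  (forall n (g g' : nat -> T),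
    (forall c, (c < n)%N -> g c = g' c) -> step n g = step n g') ->
  exists g : nat -> T, forall n, g n = step n g.
Proof.
move=> ext; pose F k := iter k (fun (g : nat -> T) n => step n g) (fun=> t0).
have stable n k k' : (n < k)%N -> (n < k')%N -> F k n = F k' n.
  elim/ltn_ind: n k k' => n IHn [//|k] [//|k'] nk nk'; apply: ext => c cn.
  by apply: IHn => //; apply: leq_trans cn _.
exists (fun n => F n.+1 n) => n; apply: ext => c cn.
exact: stable.
Qed.

Section Composition.
Variables (h : fps1 K) (h0 : h 0%N = 0) (h1 : h 1%N = 1).

(** The coefficients of g(h(x)), written with the integer powers of h. *)
Definition fps1_comp g : fps1 K := fun m =>
  \sum_(c \in [set: nat]) fps1_expz h c%:Z m%:Z * g c.

Lemma fps1_expz_diag m : fps1_expz h m m = 1.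
Proof.
rewrite /fps1_expz expzE (fsum1 (j := 0%N)) => [|k k0].
  by rewrite binz0 mul1r subrr.
apply/eqP; apply: contraNT k0; rewrite mulf_eq0 negb_or => /andP[_].
by move=> /(exp_weight (A := fps_in_x h) h0 h1) /=; lia.
Qed.

Lemma subst_in_x g : subst_fps2 (substxy h) (fps_in_x g) = fps_in_x (fps1_comp g).
Proof.
apply/funext => m; apply/funext => n; rewrite /subst_fps2 /act.
rewrite (@fsum_reindex _ _ _ (fun c : nat => (c%:Z, 0))) => [|a b []//|a]; last first.
  rewrite scaler_eq0 negb_or => /andP[_ ga]; have [c [d aE]] := ser_neq0 ga.
  by move: ga; rewrite aE /ser /fps_in_x /=; case: d {aE} => [|d];
    [exists c|rewrite eqxx].
rewrite /fps_in_x /fps1_comp /substxy /ser /GRing.scale /=.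
under eq_fsum do rewrite (fps1_expz0 h0 h1).
by case: n => [|n] /=; [under eq_fsum do rewrite mulr1|
  rewrite fsum0 // => c; rewrite mulr0 mul0r].
Qed.

Lemma subst_in_y g : subst_fps2 (substxy h) (fps_in_y g) = fps_in_y (fps1_comp g).
Proof.
apply/funext => m; apply/funext => n; rewrite /subst_fps2 /act.
rewrite (@fsum_reindex _ _ _ (fun c : nat => (0, c%:Z))) => [|a b []//|a]; last first.
  rewrite scaler_eq0 negb_or => /andP[_ ga]; have [c [d aE]] := ser_neq0 ga.
  by move: ga; rewrite aE /ser /fps_in_y /=; case: c {aE} => [|c];
    [exists d|rewrite eqxx].
rewrite /fps_in_y /fps1_comp /substxy /ser /GRing.scale /=.
under eq_fsum do rewrite (fps1_expz0 h0 h1).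
by case: m => [|m] /=; [under eq_fsum do rewrite mul1r|
  rewrite fsum0 // => c; rewrite !mul0r].
Qed.

(** The equation g(h(x)) = x is a triangular linear system for the coefficients of g. Its diagonal
    entries are 1, so it is solved recursively. *)
Lemma right_inverse : exists g : fps1 K,
  [/\ g 0%N = 0, g 1%N = 1 & fps1_comp g = fun n => (n == 1%N)%:R].
Proof.
pose step n (g : fps1 K) := (n == 1%N)%:R -
  \sum_(0 <= c < n) fps1_expz h c%:Z n%:Z * g c.
have [|g gE] := @course_of_values K 0 step.
  move=> n g g' gg'; congr (_ - _); apply: eq_big_nat => c /andP[_ cn].
  by rewrite gg'.
have g0 : g 0%N = 0 by rewrite gE /step big_geq // subr0.
exists g; split=> //; first by rewrite gE /step big_nat1 g0 mulr0 subr0.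
apply/funext => n; rewrite /fps1_comp (@fsum_seq _ _ (index_iota 0 n.+1)) ?iota_uniq //.
  by rewrite big_nat_recr //= fps1_expz_diag mul1r gE addrC subrK.
move=> c; rewrite mulf_eq0 negb_or => /andP[/(fps1_expz_neq0 h0 h1) ? _].
by rewrite mem_index_iota; lia.
Qed.

(** The product of the matrices is a substitution sending x to g(h(x)) = x and y to y, as does the
    identity; uniqueness concludes. *)
Lemma substxy_right_inverse : exists g : fps1 K,
  [/\ g 0%N = 0, g 1%N = 1 & kmul (substxy h) (substxy g) = mulk (fps2_one K)].
Proof.
have [g [g0 g1 hg]] := right_inverse; exists g; split=> //.
have sk := subst_comp (substxy_kernel h0 h1) (substxy_kernel g0 g1).
apply: (subst_uniq _ _ sk).
- by rewrite subst_in_x hg; split=> // [[|[|m]] [|n]].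
- by rewrite subst_in_y hg; split=> // [[|m] [|[|n]]].
rewrite subst_in_x subst_in_y hg.
suff [-> ->] : fps_in_x (fun n => (n == 1%N)%:R) = @fps2_x K /\
               fps_in_y (fun n => (n == 1%N)%:R) = @fps2_y K.
  exact: identity_kernel.
by split; apply/funext => m; apply/funext => n;
  rewrite /fps_in_x /fps_in_y /fps2_x /fps2_y; case: eqP; rewrite ?andbT ?andbF.
Qed.

End Composition.

(** Stated on matrices, so that negative powers are covered at once. *)
Definition inverse_series g h :=
  kmul (substxy h) (substxy g) = mulk (fps2_one K) /\
  kmul (substxy g) (substxy h) = mulk (fps2_one K).

Lemma inverse_seriesC g h : inverse_series g h -> inverse_series h g.
Proof. by case. Qed.

Lemma exists_inverse h : h 0%N = 0 -> h 1%N = 1 ->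
  exists g, [/\ g 0%N = 0, g 1%N = 1 & inverse_series g h].
Proof.
move=> h0 h1; have [g [g0 g1 hg]] := substxy_right_inverse h0 h1.
have [g' [g'0 g'1 gg']] := substxy_right_inverse g0 g1.
have low k : k 0%N = 0 -> k 1%N = 1 -> lower shear (substxy k).
  by move=> k0 k1; apply/lower_quad/lower_substxy.
exists g; split=> //; split=> //.
(* A right inverse g of h has a right inverse g' of its own, and h = h (g g') = (h g) g' = g' as
   matrices. *)
have -> // : substxy h = substxy g'.
by rewrite -[LHS]kmulk1 -gg' kmulA ?hg ?kmul1k //; apply: low.
Qed.

(** * Divisibility of x by h(x) and of x - y by h(x) - h(y) *)

Section Factorization.
Variables (g h : fps1 K).
Hypotheses (g0 : g 0%N = 0) (g1 : g 1%N = 1) (h0 : h 0%N = 0) (h1 : h 1%N = 1).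
Hypothesis gh : inverse_series g h.
Let sh := substxy_kernel h0 h1.
Let sg := substxy_kernel g0 g1.

Lemma subst_inverse A : subst_fps2 (substxy h) (subst_fps2 (substxy g) A) = A.
Proof.
apply: ser_inj; rewrite (ser_subst sh) (ser_subst sg).
rewrite (act_kmul finer_shear) ?(proj1 gh) ?act_mulk1 //.
- exact: subst_lower sh.
- exact: subst_lower sg.
- exact/upper_locfin/upper_ser.
Qed.

Lemma subst_inverse_x : subst_fps2 (substxy h) (fps_in_x g) = fps2_x.
Proof. by rewrite -(subst_fps2_x sg) subst_inverse. Qed.

Lemma subst_inverse_y : subst_fps2 (substxy h) (fps_in_y g) = fps2_y.
Proof. by rewrite -(subst_fps2_y sg) subst_inverse. Qed.

Lemma fps2_mul_shift A c d m n :
  (forall m n, A m n = ((m == c) && (n == d))%:R) ->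
  forall B, (A ** B) m n =
    if (c <= m)%N && (d <= n)%N then B (m - c)%N (n - d)%N else 0.
Proof.
move=> AE B; rewrite -[LHS]/(ser (A ** B) (m%:Z, n%:Z)) -act_mulk_ser.
rewrite (act_mulk_shift _ _ AE) /=; case: leqP => [cm|cm] /=; last first.
  by rewrite /ser /=; have -> : m%:Z - c%:Z = Negz (c - m).-1 by lia.
rewrite subzn //; case: leqP => [dn|dn] /=; first by rewrite subzn.
by rewrite /ser /=; have -> : n%:Z - d%:Z = Negz (d - n).-1 by lia.
Qed.

Lemma fps2_mulBl A B C : fps2_sub A B ** C = fps2_sub (A ** C) (B ** C).
Proof.
apply/funext => m; apply/funext => n; rewrite /fps2_sub /fps2_mul -sumrB.
by apply: eq_bigr => a _; rewrite -sumrB; apply: eq_bigr => b _; rewrite mulrBl.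
Qed.

Lemma x_factor : exists k, fps2_x = k ** fps_in_x h.
Proof.
(* The series g(x)/x evaluated at h(x), since x = g(h(x)). *)
exists (subst_fps2 (substxy h) (fps_in_x (fun n => g n.+1))).
rewrite -subst_inverse_x fps2_mulC -(subst_fps2_x sh) -(subst_fps2_mul sh).
congr subst_fps2; apply/funext => m; apply/funext => n.
rewrite (@fps2_mul_shift fps2_x 1 0) // andbT subn0 /fps_in_x.
by case: m => [|m] /=; rewrite ?subn1 // g0; case: ifP.
Qed.

Lemma diff_factor : exists k,
  fps2_sub fps2_x fps2_y = k ** fps2_sub (fps_in_x h) (fps_in_y h).
Proof.
(* The series (g(x) - g(y))/(x - y), whose coefficient of x^m y^n is that of x^(m+n+1) in g,
   evaluated at h(x), h(y). *)
exists (subst_fps2 (substxy h) (fun m n => g (m + n).+1)).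
rewrite -subst_inverse_x -subst_inverse_y -(subst_fps2_sub sh) fps2_mulC.
rewrite -(subst_fps2_x sh) -(subst_fps2_y sh) -(subst_fps2_sub sh) -(subst_fps2_mul sh).
congr subst_fps2; apply/funext => m; apply/funext => n.
rewrite fps2_mulBl {2}/fps2_sub (@fps2_mul_shift fps2_x 1 0) //.
rewrite (@fps2_mul_shift fps2_y 0 1) // /fps2_sub /fps_in_x /fps_in_y !subn0 andbT.
case: m n => [|m] [|n]; rewrite /= ?subn1 ?subn0 ?addn0 ?add0n ?subrr ?subr0 ?sub0r //.
by rewrite addSnnS subrr.
Qed.

End Factorization.

(** * Commuting x -> G(x,y) past x -> h(x), y -> h(y) *)

Section Intertwining.
Variables (h : fps1 K) (h0 : h 0%N = 0) (h1 : h 1%N = 1).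
Variables (G H : fps2 K) (G00 : G 0%N 0%N = 0) (G10 : G 1%N 0%N = 1).
Variables (H00 : H 0%N 0%N = 0) (H10 : H 1%N 0%N = 1).

Lemma substx_in_y : subst_fps2 (substx G) (fps_in_y h) = fps_in_y h.
Proof.
have expG0 i : fps2_expz G 0 i.1 i.2 = (i == (0, 0))%:R.
  have <- := subst_one (substx_kernel G00 G10) i.
  by rewrite /substx /= subr0.
apply/funext => m; apply/funext => n; rewrite /subst_fps2 /act.
rewrite (fsum1 (j := (m%:Z, n%:Z))) => [|a].
  rewrite ser_coef /fps_in_y; case: m => [|m] /=; last by rewrite scaler0.
  rewrite /substx /= subrr (expG0 (0, 0)).
  by rewrite eqxx /GRing.scale /= mul1r.
apply: contraNeq; rewrite scaler_eq0 negb_or => /andP[+ ha].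
have [c [d aE]] := ser_neq0 ha; move: ha; rewrite aE ser_coef /fps_in_y.
case: c aE => [|c] aE; last by rewrite eqxx.
move=> _; rewrite /substx /=; rewrite (expG0 (m%:Z, n%:Z - d%:Z)).
by rewrite !xpair_eqE; case: andP => [[/eqP ? /eqP ?] _|_]; [lia|rewrite eqxx].
Qed.

(** Supplies the injectivity needed in [subst_uniq]. By triangularity for [quad], only the
    coefficients of 1 and x in H contribute. *)
Lemma subst_substxy_monic : monic_at (subst_fps2 (substxy h) H) 1 0.
Proof.
apply: monic_at_x; rewrite /subst_fps2 /act.
  rewrite (fsum1 (j := (0, 0))) ?ser_coef ?H00 ?scaler0 // => a; apply: contraNeq.
  rewrite scaler_eq0 negb_or => /andP[/(lower_substxy h0 h1)].
  by rewrite /quad /= => + /ser_neq0[c [d aE]]; rewrite aE xpair_eqE /=; lia.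
rewrite (fsum1 (j := (1, 0))) => [|a].
  rewrite ser_coef H10 /substxy /= !(fps1_expz_diag h0 h1).
  by rewrite /GRing.scale /= !mulr1.
apply: contraNeq; rewrite scaler_eq0 negb_or => /andP[/(lower_substxy h0 h1)].
rewrite /quad /= => + Ha; have [c [d aE]] := ser_neq0 Ha; rewrite aE /= => le.
have d0 : d = 0%N by lia.
move: Ha; rewrite aE d0 ser_coef xpair_eqE /=.
by case: c aE le => [|[|c]] //= _ _; rewrite H00 eqxx.
Qed.

(** Both composites send x to H(h(x),h(y)) = h(G(x,y)) and y to h(y), so they agree on all integer
    powers. *)
Lemma substx_intertwine :
  subst_fps2 (substxy h) H = subst_fps2 (substx G) (fps_in_x h) ->
  kmul (substxy h) (substx H) = kmul (substx G) (substxy h).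
Proof.
move=> HG; have sT := substxy_kernel h0 h1.
have sTE := subst_comp sT (substx_kernel H00 H10).
have := subst_comp (substx_kernel G00 G10) sT.
rewrite -HG substx_in_y -{1}(subst_fps2_y sT); apply: subst_uniq sTE.
  exact: subst_substxy_monic.
by rewrite (subst_fps2_y sT); apply: monic_at_in_y.
Qed.

(** Translates to [fps_comp], in which the logarithm is formulated. *)
Lemma substx_in_xE : subst_fps2 (substx G) (fps_in_x h) = fps_comp h G.
Proof.
apply/funext => m; apply/funext => n; rewrite /subst_fps2 /act /fps_comp.
rewrite (@fsum_reindex _ _ _ (fun c : nat => (c%:Z, 0))) => [|a b []//|a]; last first.
  rewrite scaler_eq0 negb_or => /andP[_ ga]; have [c [d aE]] := ser_neq0 ga.
  by move: ga; rewrite aE /ser /fps_in_x /=; case: d {aE} => [|d];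
    [exists c|rewrite eqxx].
apply: eq_fsum => c; rewrite /GRing.scale /= mulrC; congr (_ * _).
have /(congr1 (fun S => S (m%:Z, n%:Z))) /= -> := subst_col (substx_kernel G00 G10) c 0.
by rewrite fps2_mul1.
Qed.

End Intertwining.
End Inverse.

(** * Twisting vertex operators *)

Section Twist.
Variable K : fieldType.
Implicit Types (V W : vertex_data K) (g h : fps1 K) (G H : fps2 K).

Local Notation "A ** B" := (fps2_mul A B) (at level 40, left associativity).

Lemma opp_pred_bij : bijective (fun n : int => - n - 1).
Proof. by exists (fun n : int => - n - 1) => n; rewrite opprD opprK addrK. Qed.

Lemma twist_modeE h V (u v : V) m :
  mode (u : twist h V) m v =
  \sum_(p \in [set: int]) fps1_expz h p (- m - 1) *: mode u (- p - 1) v.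
Proof.
rewrite /= (@reindex_fsbigT _ _ _ _ _ (fun n : int => - n - 1)); last exact: opp_pred_bij.
by apply: eq_fsum => p; rewrite !opprD !opprK !addrK.
Qed.

Lemma uniform_lower_bound (T : eqType) (s : seq T) (P : T -> int -> Prop) :
  (forall q, exists N : int, forall p, P q p -> N <= p) ->
  exists N : int, forall q p, q \in s -> P q p -> N <= p.
Proof.
move=> bound; elim: s => [|q s [N IHs]]; first by exists 0.
have [N' N'P] := bound q; exists (Num.min N N') => q' p.
rewrite inE => /predU1P[->|q's] /=; first by move=> /N'P; lia.
by move=> /(IHs _ _ q's); lia.
Qed.

(** The hypotheses say that S lies in W((x))((y)). Below i only finitely many rows occur, so a
    common lower bound for the exponents of x exists. *)
Lemma locfin_iterated (W : lmodType K) (S : int * int -> W) :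
  (exists J, forall p, S p != 0 -> J <= p.2) ->
  (forall q, exists I, forall p, S (p, q) != 0 -> I <= p) -> locfin shear S.
Proof.
move=> [J SJ] SI i.
have [I IP] := uniform_lower_bound (zrange J i.2) SI.
exists (box (I, J) i) => -[p q] pi Sp; have /= Jq := SJ _ Sp.
have Ip : I <= p by apply: (IP q) => //; apply: mem_zrange; case/andP: pi.
by apply: mem_box; rewrite // /shear /=; lia.
Qed.

Lemma locfin_flip (W : lmodType K) (S : int * int -> W) :
  locfin quad S -> locfin quad (fun p => S (p.2, p.1)).
Proof.
move=> lS i; have [s sP] := lS (i.2, i.1).
exists [seq (p.2, p.1) | p <- s] => -[p q] pi Sp; apply/mapP; exists (q, p) => //.
by apply: sP => //; move: pi; rewrite /quad /= andbC.
Qed.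

(** * Supports of products of vertex operators, and their twists *)

Section Operator.
Variables (V : vertex_data K) (opV : is_vertex_operator V).

Lemma mode_lower_bound (u v : V) :
  exists N, forall p, mode u (- p - 1) v != 0 -> N <= p.
Proof.
have [N NP] := mode_truncation opV u v; exists (- N) => p.
by apply: contraR => pN; rewrite NP //; lia.
Qed.

Definition YYser (u v w : V) : int * int -> V := fun p => YY u v w p.1 p.2.
Definition Y_Yser (u v w : V) : int * int -> V := fun p => Y_Y u v w p.1 p.2.

Lemma locfin_YY u v w : locfin shear (YYser u v w).
Proof.
apply: locfin_iterated => [|q];
  last exact: (mode_lower_bound u (mode v (- q - 1) w)).
have [N NP] := mode_lower_bound v w; exists N => p; apply: contraR => pN.
rewrite /YYser /YY (contraNeq (@NP _) pN).
by rewrite (linear_zero (mode_linear_r opV _ _)).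
Qed.

(** This series lies in V((y))((x)), with the variables in the opposite order. Hence the flip, which
    [quad] allows because it is symmetric in the two coordinates. *)
Lemma locfin_Y_Y u v w : locfin quad (Y_Yser u v w).
Proof.
apply: (@locfin_flip _ (fun p => Y_Yser u v w (p.2, p.1))).
apply/locfin_quad/locfin_iterated => [|q];
  last exact: (mode_lower_bound (mode u (- q - 1) v) w).
have [N NP] := mode_lower_bound u v; exists N => p; apply: contraR => pN.
rewrite /Y_Yser /Y_Y /= (contraNeq (@NP _) pN).
by apply/eqP; exact: (linear_zero (mode_linear_l opV (- p.1 - 1) w)).
Qed.

Lemma YF_Y_act H u v w i j :
  YF_Y H u v w i j = act (substx H) (YYser u v w) (i, j).
Proof.
rewrite /YF_Y /act.
rewrite (@reindex_fsbigT _ _ _ _ _ (fun p : int * int => (- p.1 - 1, - p.2 - 1))).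
  apply: eq_fsum => -[p q]; rewrite /substx /YYser /YY /=.
  have -> : - (- p - 1) - 1 = p by lia.
  by have -> : j + (- q - 1) + 1 = j - q by lia.
by exists (fun p : int * int => (- p.1 - 1, - p.2 - 1)) => -[p q] /=; congr (_, _); lia.
Qed.

Section OneSeries.
Variables (h : fps1 K) (h0 : h 0%N = 0) (h1 : h 1%N = 1).

Lemma twist_support (u v : V) m : exists s : seq int, forall p,
  fps1_expz h p (- m - 1) *: mode u (- p - 1) v != 0 -> p \in s.
Proof.
have [N NP] := mode_lower_bound u v; exists (zrange N (- m - 1)) => p.
rewrite scaler_eq0 negb_or => /andP[/(fps1_expz_neq0 h0 h1) ? /NP ?].
exact: mem_zrange.
Qed.

Lemma twist_operator : is_vertex_operator (twist h V).
Proof.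
split=> [n v a u u'|u n a v v'|u v].
- rewrite !twist_modeE scale_fsumr.
  have [s sP] := twist_support u v n; have [t tP] := twist_support u' v n.
  rewrite -(@fsum_add _ _ (s ++ t)) => [|p|p].
  + apply: eq_fsum => p; rewrite (mode_linear_l opV) scalerDr; congr (_ + _).
    by rewrite scalerA mulrC -scalerA.
  + by rewrite scaler_eq0 negb_or mem_cat => /andP[_ /sP ->].
  + by rewrite mem_cat => /tP ->; rewrite orbT.
- rewrite !twist_modeE scale_fsumr.
  have [s sP] := twist_support u v n; have [t tP] := twist_support u v' n.
  rewrite -(@fsum_add _ _ (s ++ t)) => [|p|p].
  + apply: eq_fsum => p; rewrite (mode_linear_r opV) scalerDr; congr (_ + _).
    by rewrite scalerA mulrC -scalerA.
  + by rewrite scaler_eq0 negb_or mem_cat => /andP[_ /sP ->].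
  + by rewrite mem_cat => /tP ->; rewrite orbT.
- have [N NP] := mode_lower_bound u v; exists (- N) => m Nm.
  rewrite twist_modeE fsum0 // => p; apply/eqP; apply: contraLR Nm.
  rewrite scaler_eq0 negb_or => /andP[/(fps1_expz_neq0 h0 h1) ? /NP ?].
  by lia.
Qed.

(** Neither Y(1,x) nor Y(v,x)1 has negative exponents, h^0 = 1 and h^p starts at x^p; so no negative
    exponent appears and the constant term is kept. *)
Lemma twist_vacuum : vacuum_creation V -> vacuum_creation (twist h V).
Proof.
case=> vac reg lim; split=> [n v|v n n0|v].
- rewrite twist_modeE (fsum1 (j := 0)) => [|p p0]; rewrite vac.
    rewrite (fps1_expz0 h0 h1) eqxx; have -> : (- n - 1 == 0) = (n == -1) by lia.
    by case: ifP; rewrite ?scale1r ?scale0r.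
  by case: eqP => [|_]; [lia|rewrite scaler0].
- rewrite twist_modeE fsum0 // => p; apply/eqP.
  have [p0|p0] := ltP p 0; first by rewrite reg ?scaler0 //; lia.
  rewrite scaler_eq0; apply/orP; left; apply: contraTT n0.
  by move=> /(fps1_expz_neq0 h0 h1); lia.
- rewrite twist_modeE (fsum1 (j := 0)) => [|p p0].
    by rewrite (fps1_expz0 h0 h1) scale1r lim.
  have [pn|pp] := ltP p 0; first by rewrite reg ?scaler0 //; lia.
  apply/eqP; rewrite scaler_eq0; apply/orP; left.
  have pgt : 0 < p by rewrite lt_neqAle eq_sym p0.
  by apply: contraTT pgt => /(fps1_expz_neq0 h0 h1); lia.
Qed.

Lemma YY_twist (u v w : V) i j :
  YY (u : twist h V) v w i j = act (substxy h) (YYser u v w) (i, j).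
Proof.
have [s sP] := locfin_quad (locfin_YY u v w) (i, j).
have inner p : mode u (- p - 1) (mode (v : twist h V) (- j - 1) w) =
    \sum_(q \in [set: int]) fps1_expz h q j *: YY u v w p q.
  have [t tP] := twist_support v w (- j - 1).
  rewrite twist_modeE (fsum_linear (mode_linear_r opV u (- p - 1)) tP).
  by apply: eq_fsum => q; rewrite (linear_scale _ _ (mode_linear_r opV _ _))
    opprD !opprK addrK.
rewrite /YY twist_modeE opprD !opprK addrK.
under eq_fsum do rewrite inner scale_fsumr.
rewrite /act (@fsum_pair _ _ _ _ [seq p.1 | p <- s] [seq p.2 | p <- s]) => [|p q].
  by apply: eq_fsum => p; apply: eq_fsum => q; rewrite scalerA.
rewrite scaler_eq0 negb_or => /andP[/(lower_substxy h0 h1)/sP + Sp].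
by move=> /(_ Sp) ps; apply/andP; split; apply/mapP; exists (p, q).
Qed.

Lemma Y_Y_twist (u v w : V) i j :
  Y_Y (u : twist h V) v w i j = act (substxy h) (Y_Yser u v w) (i, j).
Proof.
have [s sP] := locfin_Y_Y u v w (i, j).
have inner q : mode (mode (u : twist h V) (- i - 1) v : V) (- q - 1) w =
    \sum_(p \in [set: int]) fps1_expz h p i *: Y_Y u v w p q.
  have [t tP] := twist_support u v (- i - 1).
  rewrite twist_modeE (fsum_linear (mode_linear_l opV (- q - 1) w) tP).
  by apply: eq_fsum => p; rewrite (linear_scale _ _ (mode_linear_l opV (- q - 1) w))
    opprD !opprK addrK.
have bound p q : substxy h (i, j) (p, q) *: Y_Yser u v w (p, q) != 0 ->
    (p \in [seq p.1 | p <- s]) && (q \in [seq p.2 | p <- s]).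
  rewrite scaler_eq0 negb_or => /andP[/(lower_substxy h0 h1)/sP + Sp].
  by move=> /(_ Sp) ps; apply/andP; split; apply/mapP; exists (p, q).
rewrite /Y_Y twist_modeE opprD !opprK addrK.
under eq_fsum do rewrite inner scale_fsumr.
(* Here x belongs to the inner operator, so the sums over p and q come in the opposite order. *)
rewrite /act (fsum_pair bound) (fsum_exchange bound).
by apply: eq_fsum => q; apply: eq_fsum => p; rewrite scalerA mulrC.
Qed.

End OneSeries.
End Operator.

(** * Transport of associativity, commutativity and homomorphisms *)

Section TwistAxioms.
Variables (g h : fps1 K).
Hypotheses (g0 : g 0%N = 0) (g1 : g 1%N = 1) (h0 : h 0%N = 0) (h1 : h 1%N = 1).
Hypothesis gh : inverse_series g h.
Let sT := substxy_kernel h0 h1.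
Let lT := lower_substxy h0 h1.

Lemma fps2_act_eqP (W : lmodType K) A (S T : int -> int -> W) :
  fps2_act A S = fps2_act A T <->
  act (mulk A) (fun p => S p.1 p.2) = act (mulk A) (fun p => T p.1 p.2).
Proof.
split=> [eqST|eqST].
  by apply/funext => -[i j]; rewrite -!fps2_actE eqST.
by apply/funext => i; apply/funext => j; rewrite !fps2_actE eqST.
Qed.

(** The step shared by both axioms: substitute in the identity multiplied by A^n, then multiply by
    k^n, which turns the image of A^n into B^n. *)
Lemma act_substxy_exp (W : lmodType K) A B k n (S T : int * int -> W) :
  B = k ** subst_fps2 (substxy h) A -> locfin quad S -> locfin quad T ->
  act (mulk (fps2_exp A n)) S = act (mulk (fps2_exp A n)) T ->
  act (mulk (fps2_exp B n)) (act (substxy h) S) =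
  act (mulk (fps2_exp B n)) (act (substxy h) T).
Proof.
move=> BE lS lT' eqST.
have step (R : int * int -> W) : locfin quad R ->
    act (mulk (fps2_exp B n)) (act (substxy h) R) =
    act (mulk (fps2_exp k n)) (act (substxy h) (act (mulk (fps2_exp A n)) R)).
  move=> lR; rewrite BE fps2_expM (act_mulk_mul _ _ finer_quad) //; last first.
    by apply: (locfin_act finer_quad).
  by rewrite -(subst_fps2_exp sT) (act_subst_mulk sT _ finer_quad).
by rewrite !step // eqST.
Qed.

Lemma twist_assoc G H V :
  G 0%N 0%N = 0 -> G 1%N 0%N = 1 -> H 0%N 0%N = 0 -> H 1%N 0%N = 1 ->
  subst_fps2 (substxy h) H = subst_fps2 (substx G) (fps_in_x h) ->
  is_vertex_operator V -> weak_F_associativity H V ->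
  weak_F_associativity G (twist h V).
Proof.
move=> G00 G10 H00 H10 HG opV assoc u v w; have [l lP] := assoc u v w; exists l.
have sG := substx_kernel G00 G10; have sH := substx_kernel H00 H10.
have [k0 xE] := x_factor g0 g1 h0 h1 gh.
(* Apply x -> G(x,y) to the factorization of x by h(x), and use h(G(x,y)) = H(h(x),h(y)). *)
have GE : G = subst_fps2 (substx G) k0 ** subst_fps2 (substxy h) H.
  by rewrite HG -(subst_fps2_mul sG) -xE (subst_fps2_x sG).
have lC := locfin_YY opV u v w.
have lsT := subst_lower sT.
apply/fps2_act_eqP.
(* By intertwining, twisting and then substituting G equals substituting H and then twisting. *)
have -> : (fun p => YF_Y G (u : twist h V) v w p.1 p.2) =
    act (substxy h) (act (substx H) (YYser (V := V) u v w)).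
  apply/funext => -[i j].
  have tE : YYser (u : twist h V) v w = act (substxy h) (YYser (V := V) u v w).
    by apply/funext => -[a b]; exact: (YY_twist opV h0 h1 u v w a b).
  rewrite YF_Y_act tE !(act_kmul finer_shear)
    ?(substx_intertwine h0 h1 G00 G10 H00 H10 HG) //.
  - exact: subst_lower sG.
  - exact: subst_lower sH.
have -> : (fun p => Y_Y (u : twist h V) v w p.1 p.2) =
    act (substxy h) (Y_Yser (V := V) u v w).
  by apply/funext => -[i j]; exact: (Y_Y_twist opV h0 h1 u v w i j).
apply: (act_substxy_exp GE).
- by apply: locfin_quad; apply: (locfin_act finer_shear) => //; exact: subst_lower sH.
- exact: locfin_Y_Y.
have /fps2_act_eqP := lP.
have -> // : (fun p => YF_Y (V := V) H u v w p.1 p.2) =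
    act (substx H) (YYser (V := V) u v w).
by apply/funext => -[i j]; exact: (YF_Y_act (V := V) H u v w i j).
Qed.

Lemma act_substxy_flip (W : lmodType K) (S : int * int -> W) i j :
  act (substxy h) S (j, i) = act (substxy h) (fun p => S (p.2, p.1)) (i, j).
Proof.
rewrite /act (@reindex_fsbigT _ _ _ _ _ (fun p : int * int => (p.2, p.1))).
  by apply: eq_fsum => p; rewrite /substxy /= mulrC.
by exists (fun p : int * int => (p.2, p.1)) => -[].
Qed.

Lemma twist_commutativity V :
  is_vertex_operator V -> weak_commutativity V -> weak_commutativity (twist h V).
Proof.
move=> opV comm u v; have [k kP] := comm u v; exists k => w.
have [k0 dE] := diff_factor g0 g1 h0 h1 gh.
rewrite -(subst_fps2_x sT) -(subst_fps2_y sT) -(subst_fps2_sub sT) in dE.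
apply/fps2_act_eqP.
have -> : (fun p => YY (u : twist h V) v w p.1 p.2) =
    act (substxy h) (YYser (V := V) u v w).
  by apply/funext => -[i j]; exact: (YY_twist opV h0 h1 u v w i j).
have -> : (fun p => YY (v : twist h V) u w p.2 p.1) =
    act (substxy h) (fun p => YYser (V := V) v u w (p.2, p.1)).
  by apply/funext => -[i j]; rewrite -act_substxy_flip;
    exact: (YY_twist opV h0 h1 v u w j i).
apply: (act_substxy_exp dE).
- exact/locfin_quad/locfin_YY.
- exact/locfin_flip/locfin_quad/locfin_YY.
- exact: (proj1 (fps2_act_eqP _ _ _) (kP w)).
Qed.

Lemma twist_hom V W (theta : V -> W) :
  is_vertex_operator V -> is_vertex_hom theta ->
  @is_vertex_hom K (twist h V) (twist h W) theta.
Proof.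
move=> opV [lin vac mod]; split=> // u v n.
have [s sP] := twist_support opV h0 h1 u v n.
rewrite !twist_modeE (fsum_linear lin sP); apply: eq_fsum => p.
by rewrite (linear_scale _ _ lin) mod.
Qed.

(** A series in x alone is placed in the row y^0, so that the inverse relation between the matrices
    applies to a single vertex operator. *)
Lemma act_substxy_row (W : lmodType K) (S : int -> W) k :
  k 0%N = 0 -> k 1%N = 1 ->
  act (substxy k) (fun p => if p.2 == 0 then S p.1 else 0) =
  fun i => if i.2 == 0 then \sum_(p \in [set: int]) fps1_expz k p i.1 *: S p else 0.
Proof.
move=> k0 k1; apply/funext => -[i j] /=.
rewrite /act (@fsum_reindex _ _ _ (fun p : int => (p, 0))) => [|p q []//|[p q]] /=.
  rewrite /substxy /= (fps1_expz0 k0 k1); case: eqP => _.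
    by apply: eq_fsum => p; rewrite mulr1.
  by rewrite fsum0 // => p; rewrite mulr0 scale0r.
by case: ifP => [/eqP -> _|_]; [exists p|rewrite scaler0 eqxx].
Qed.

Lemma twist_twist V (u v : V) n : is_vertex_operator V ->
  mode (u : twist h (twist g V)) n v = mode u n v.
Proof.
move=> opV; rewrite twist_modeE.
under eq_fsum do rewrite twist_modeE opprD !opprK addrK.
pose S p := mode u (- p - 1) v.
pose S2 (p : int * int) := if p.2 == 0 then S p.1 else 0.
have lS2 : locfin shear S2.
  apply: locfin_iterated => [|q].
    by exists 0 => -[p q]; rewrite /S2 /=; case: ifP => [/eqP ->|_] //; rewrite eqxx.
  have [N NP] := mode_lower_bound opV u v; exists N => p.
  by rewrite /S2 /=; case: ifP => _; [exact: NP|rewrite eqxx].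
have := act_kmul finer_shear (subst_lower sT)
  (subst_lower (substxy_kernel g0 g1)) lS2.
rewrite (proj1 gh) act_mulk1 /S2 act_substxy_row //.
rewrite (act_substxy_row (fun p => \sum_(q \in [set: int]) fps1_expz g q p *: S q)) //.
move=> /(congr1 (fun R => R (- n - 1, 0))) /= E.
rewrite E /S; congr (mode u _ v); lia.
Qed.

End TwistAxioms.
End Twist.

(** * The isomorphism of categories *)

Section Equivalence.
Variable K : fieldType.

Lemma subst_kmul (Q Q' : kernel K) (X Y X' Y' A : fps2 K) :
  subst_kernel Q X Y -> subst_kernel Q' X' Y' ->
  subst_fps2 (kmul Q Q') A = subst_fps2 Q (subst_fps2 Q' A).
Proof.
move=> sQ sQ'; apply: ser_inj.
rewrite (ser_subst (subst_comp sQ sQ')) (ser_subst sQ) (ser_subst sQ').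
rewrite (act_kmul finer_shear) //.
- exact: subst_lower sQ.
- exact: subst_lower sQ'.
- exact/upper_locfin/upper_ser.
Qed.

(** * Twisting by the logarithm and by its inverse *)

Section Logarithm.
Variables (F : fps2 K) (f g : fps1 K).
Hypotheses (hF : formal_group F) (hf : is_log F f).
Hypotheses (g0 : g 0%N = 0) (g1 : g 1%N = 1) (gf : inverse_series g f).
Let f0 := log_0 hf.
Let f1 := log_deriv0 hf.
Let F00 : F 0%N 0%N = 0 := formal_group_x0 hF 0.
Let F10 : F 1%N 0%N = 1 := formal_group_x0 hF 1.

Lemma additive_fg00 : @additive_fg K 0%N 0%N = 0.
Proof. by rewrite /additive_fg /fps2_add addr0. Qed.

Lemma additive_fg10 : @additive_fg K 1%N 0%N = 1.
Proof. by rewrite /additive_fg /fps2_add addr0. Qed.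

Let A00 := additive_fg00.
Let A10 := additive_fg10.

Lemma log_subst :
  subst_fps2 (substxy f) additive_fg = subst_fps2 (substx F) (fps_in_x f).
Proof.
have sT := substxy_kernel f0 f1.
rewrite (substx_in_xE f F00 F10) (log_morph hf) /additive_fg.
by rewrite (subst_fps2_add sT) (subst_fps2_x sT) (subst_fps2_y sT).
Qed.

(** This is F(g(x),g(y)) = g(x+y). The intertwining relation for f is multiplied by the matrix of g
    on both sides, and the result is applied to x. *)
Lemma exp_subst :
  subst_fps2 (substxy g) F = subst_fps2 (substx additive_fg) (fps_in_x g).
Proof.
have [sf sg] := (substxy_kernel f0 f1, substxy_kernel g0 g1).
have [sF sA] := (substx_kernel F00 F10, substx_kernel A00 A10).
have [lf lg] := (subst_lower sf, subst_lower sg).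
have [lF lA] := (subst_lower sF, subst_lower sA).
have low := lower_kmul finer_shear.
have inter : kmul (substx additive_fg) (substxy g) = kmul (substxy g) (substx F).
  rewrite -[LHS]kmul1k -(proj2 gf) -kmulA //; last exact: low.
  rewrite (kmulA lf lA lg) (substx_intertwine f0 f1 F00 F10 A00 A10 log_subst).
  by rewrite -(kmulA lF lf lg) (proj1 gf) kmulk1.
rewrite -{1}(subst_fps2_x sF) -(subst_kmul _ sg sF) -inter.
by rewrite (subst_kmul _ sA sg) (subst_fps2_x sg).
Qed.

Lemma twist_log_nonlocal (V : vertex_data K) :
  nonlocal_vertex_algebra V -> nonlocal_vertex_F_algebra F (twist f V).
Proof.
case=> op vac assoc; split.
- exact: twist_operator.
- exact: twist_vacuum.
- exact: (twist_assoc g0 g1 f0 f1 gf F00 F10 A00 A10 log_subst).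
Qed.

Lemma twist_exp_nonlocal (V : vertex_data K) :
  nonlocal_vertex_F_algebra F V -> nonlocal_vertex_algebra (twist g V).
Proof.
case=> op vac assoc; split.
- exact: twist_operator.
- exact: twist_vacuum.
- exact: (twist_assoc f0 f1 g0 g1 (inverse_seriesC gf) A00 A10 F00 F10 exp_subst).
Qed.

Lemma twist_log_vertex (V : vertex_data K) :
  vertex_algebra V -> vertex_F_algebra F (twist f V).
Proof.
case=> nl comm; split; first exact: twist_log_nonlocal.
exact: (twist_commutativity g0 g1 f0 f1 gf (nlv_operator nl)).
Qed.

Lemma twist_exp_vertex (V : vertex_data K) :
  vertex_F_algebra F V -> vertex_algebra (twist g V).
Proof.
case=> nl comm; split; first exact: twist_exp_nonlocal.
exact: (twist_commutativity f0 f1 g0 g1 (inverse_seriesC gf) (nlv_operator nl)).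
Qed.

End Logarithm.

(** The types of the morphism parts depend on the object parts, so images of morphisms are compared
    as dependent pairs with their source and target. *)
Lemma functor_eq (C D : category) (S T : functor C D) :
  (forall a, fob S a = fob T a) ->
  (forall a b (h : Defs.hom a b),
    existT (fun ab : D * D => Defs.hom ab.1 ab.2) (fob S a, fob S b) (fmap S h) =
    existT (fun ab : D * D => Defs.hom ab.1 ab.2) (fob T a, fob T b) (fmap T h)) ->
  S = T.
Proof.
case: S T => [So Sm Sid Scomp] [To Tm Tid Tcomp] /= /funext eqo.
subst To => eqm.
have eqm' : Sm = Tm.
  apply/functional_extensionality_dep => a.
  apply/functional_extensionality_dep => b.
  apply/funext => h; have e := projT2_eq (eqm a b h).
  (* The equality of source and target is now a loop, which proof irrelevance replaces by
     reflexivity. *)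
  by rewrite (Prop_irrelevance (projT1_eq (eqm a b h)) erefl) in e.
subst Tm; congr Functor; exact: Prop_irrelevance.
Qed.

(** Twisting changes only the modes. With carriers and vacua fixed, equal modes can be substituted
    and all remaining differences are between proofs. *)
Lemma vertex_hom_eq (P : vertex_data K -> Prop) (U W : lmodType K)
    (mU mU' : U -> int -> U -> U) (mW mW' : W -> int -> W -> W) (vU : U) (vW : W)
    pU pU' pW pW' (theta : U -> W) q q' :
  mU' = mU -> mW' = mW ->
  existT (fun ab : vertex_category P * vertex_category P => Defs.hom ab.1 ab.2)
    (exist P (VertexData mU' vU) pU', exist P (VertexData mW' vW) pW')
    (exist _ theta q') =
  existT (fun ab : vertex_category P * vertex_category P => Defs.hom ab.1 ab.2)
    (exist P (VertexData mU vU) pU, exist P (VertexData mW vW) pW)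
    (exist _ theta q).
Proof.
move=> eU eW; subst mU' mW'.
rewrite (Prop_irrelevance pU' pU) (Prop_irrelevance pW' pW).
by rewrite (Prop_irrelevance q' q).
Qed.

Section Isomorphism.
Variables (f g : fps1 K) (P Q : vertex_data K -> Prop).

Lemma twist_functor_comp_id
    (Hf : forall V, P V -> Q (twist f V))
    (Hg : forall V, Q V -> P (twist g V)) Hf' Hg' :
  (forall V, P V -> forall (u v : V) n,
     mode (u : twist g (twist f V)) n v = mode u n v) ->
  functor_comp (@twist_functor K g Q P Hg Hg') (@twist_functor K f P Q Hf Hf') =
  functor_id (vertex_category P).
Proof.
move=> gf.
have modeE (U : lmodType K) m v (pV : P (@VertexData K U m v)) :
    @mode K (twist g (twist f (@VertexData K U m v))) = m.
  by apply/funext => u; apply/funext => n; apply/funext => w; apply: (gf _ pV).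
apply: functor_eq => [[[U m v] pV]|[[U mU vU] pU] [[W mW vW] pW] [theta q]].
  apply: eq_exist; exact: (congr1 (fun m' => VertexData m' v) (modeE _ _ _ pV)).
exact: (vertex_hom_eq _ _ (modeE _ _ _ pU) (modeE _ _ _ pW)).
Qed.

End Isomorphism.

(** [P] and [Q] stay abstract so that one argument serves both the commutative and the nonlocal
    categories. *)
Lemma twist_isomorphism (f g : fps1 K) (P Q : vertex_data K -> Prop) :
  f 0%N = 0 -> f 1%N = 1 -> g 0%N = 0 -> g 1%N = 1 -> inverse_series g f ->
  (forall V, P V -> is_vertex_operator V) ->
  (forall V, Q V -> is_vertex_operator V) ->
  (forall V, P V -> Q (twist f V)) -> (forall V, Q V -> P (twist g V)) ->
  twist_is_isomorphism f P Q.
Proof.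
move=> f0 f1 g0 g1 gf opP opQ Hf Hg.
have Hf' (V W : vertex_data K) (theta : V -> W) (pV : P V) (pW : P W) :=
  twist_hom f0 f1 (theta := theta) (opP V pV).
have Hg' (V W : vertex_data K) (theta : V -> W) (qV : Q V) (qW : Q W) :=
  twist_hom g0 g1 (theta := theta) (opQ V qV).
exists Hf, Hf', (twist_functor Hg Hg').
split; apply: twist_functor_comp_id => V pV u v n.
- exact: (twist_twist f0 f1 g0 g1 (inverse_seriesC gf) u v n (opP V pV)).
- exact: (twist_twist g0 g1 f0 f1 gf u v n (opQ V pV)).
Qed.

End Equivalence.

Theorem theorem3p7 (R : realType) (F : fps2 R[i]) (f : fps1 R[i])
    (hF : formal_group F) (hf : is_log F f) :
  twist_is_isomorphism f (@vertex_algebra R[i]) (vertex_F_algebra F) /\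
  twist_is_isomorphism f (@nonlocal_vertex_algebra R[i])
    (nonlocal_vertex_F_algebra F).
Proof.
have [f0 f1] := (log_0 hf, log_deriv0 hf).
have [g [g0 g1 gf]] := exists_inverse f0 f1.
split; apply: (twist_isomorphism f0 f1 g0 g1 gf).
- by move=> V [[]].
- by move=> V [[]].
- exact: (twist_log_vertex hF hf g0 g1 gf).
- exact: (twist_exp_vertex hF hf g0 g1 gf).
- by move=> V [].
- by move=> V [].
- exact: (twist_log_nonlocal hF hf g0 g1 gf).
- exact: (twist_exp_nonlocal hF hf g0 g1 gf).
Qed.
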